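(* There exist positive absolute constants $b_3,C_5,C_6$ such that the following holds. Let $\Sigma$, $\mathbf u^*$, $\lambda_1>\lambda_2\ge\dots\ge\lambda_d\ge0$ and the samples $X^{(1)},X^{(2)},\ldots$ be as in the context, let $\mathbf u^{(0)}$ be sampled uniformly from the unit sphere $\mathcal S^{d-1}$, independently of the samples, and run the online PCA algorithm with stepsize $\beta=\bar\beta(N)=\frac{2\log N}{(\lambda_1-\lambda_2)N}$. Then for any $\varepsilon_0\in(0,1/8)$, $N\ge1$, $\delta>0$ satisfying $$\text{(A)}\qquad d\left[\lambda_1^2(\lambda_1-\lambda_2)^{-1}\bar\beta(N)\right]^{1-2\varepsilon_0}=d\left[\frac{\lambda_1^2}{(\lambda_1-\lambda_2)^2}\cdot\frac{2\log N}{N}\right]^{1-2\varepsilon_0}\le b_3\delta^2$$ and $$\text{(B)}\qquad 4dN^*_{\bar\beta(N),2}\exp\left(-C_6[\lambda_1^2(\lambda_1-\lambda_2)^{-1}\bar\beta(N)]^{-2\varepsilon_0}\right)\le\delta,$$ there exists an event $\mathcal A_*$ with $\mathbb P(\mathcal A_* )\ge1-2\delta$ such that: (a) There is a factor $C^{(1)}(d,N,\delta)$ such that $$\mathbb E\left[\tan^2\angle(\mathbf u^{(N)},\mathbf u^* );\mathcal A_*\right]\le C^{(1)}(d,N,\delta)\cdot\frac{\lambda_1}{\lambda_1-\lambda_2}\sum_{k=2}^d\frac{\lambda_k}{\lambda_1-\lambda_k}\cdot\frac{\log N}{N},$$ and $C^{(1)}(d,N,\delta)\to C_5$ as $d\to\infty$,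 $N\to\infty$ when (A), (B) hold and $d^{-1}\sum_{k=2}^d\frac{\lambda_k}{\lambda_1-\lambda_k}$ is bounded away from $0$. (b) There is a factor $C^{(2)}(d,N,\delta)$ such that $$\mathbb E\left[\tan^2\angle(\mathbf u^{(N)},\mathbf u^* );\mathcal A_*\right]\le C^{(2)}(d,N,\delta)\cdot\frac{\lambda_1\lambda_2}{(\lambda_1-\lambda_2)^2}\cdot\frac{(d-1)\log N}{N},$$ and $C^{(2)}(d,N,\delta)\to C_5$ as $d\to\infty$, $N\to\infty$ when (A) holds and $\lambda_2/\lambda_1$ is bounded away from $0$.
   Context: Notation: $\|\cdot\|$ is the Euclidean norm, $\mathcal S^{d-1}=\{\mathbf u\in\mathbb R^d:\|\mathbf u\|=1\}$, $\angle(\mathbf u,\mathbf w)=\arccos(\mathbf u^\top\mathbf w)\in[0,\pi]$ for unit vectors, $\mathbb E[X;\mathcal A]=\mathbb E[X\mathbf 1_{\mathcal A}]$, $\lceil x\rceil$ is the smallest integer $\ge x$. ''Absolute constant'' means independent of all other quantities (dimension, distribution, sample size, etc.). For a real random variable $Y$, $\|Y\|_{\psi_2}=\sup_{p\ge1}p^{-1/2}(\mathbb E|Y|^p)^{1/p}$. Data: $\Sigma\in\mathbb R^{d\times d}$ is symmetric positive semidefinite with eigenvalues $\lambda_1>\lambda_2\ge\dots\ge\lambda_d\ge0$, and $\mathbf u^*$ is a unit eigenvector for $\lambda_1$. $Z\in\mathbb R^d$ is a random vector with $\mathbb E[Z]=0$, $\mathbb E[ZZ^\top]=\mathbf I_d$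 and $\sup_{\mathbf v\in\mathcal S^{d-1}}\|\mathbf v^\top Z\|_{\psi_2}\le1$. The samples $X^{(1)},X^{(2)},\ldots$ are i.i.d. copies of $X=\Sigma^{1/2}Z$, where $\Sigma^{1/2}$ is the symmetric positive semidefinite square root of $\Sigma$. Online PCA algorithm with stepsize $\beta>0$: starting from $\mathbf u^{(0)}\in\mathcal S^{d-1}$, for $n\ge1$, $\mathbf u^{(n)}=\Pi\{\mathbf u^{(n-1)}+\beta X^{(n)}(X^{(n)})^\top\mathbf u^{(n-1)}\}$, where $\Pi\mathbf w=\mathbf w/\|\mathbf w\|$ for $\mathbf w\ne0$. Rescaled time: for $s>0$, $$N^*_{\beta,s}=\left\lceil\frac{s\log(\lambda_1^{-2}(\lambda_1-\lambda_2)\beta^{-1})}{-\log(1-\beta(\lambda_1-\lambda_2))}\right\rceil.$$ The factors $C^{(1)}(d,N,\delta)$, $C^{(2)}(d,N,\delta)$ are deterministic quantities; the notation suppresses their dependence on the eigenvalues $\lambda_1,\dots,\lambda_d$ and on $\varepsilon_0$. The limits are along families of problems (the eigenvalues and $\delta$ may vary with $d,N$, with $\varepsilon_0$ fixed) satisfying the indicated conditions.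
   Formalization: The bounds in (a) and (b) are asserted only when $\lambda_2>0$; for $\lambda_2=0$ both right-hand sides vanish while the expectation is positive whenever $\mathbb P(\mathcal A_* )>0$, so no finite factor works. The case N=1 (β=0, N* undefined) is excluded. *)

(* Defs.v *)
From HB Require Import structures.
From mathcomp Require Import all_boot all_order all_algebra.
From mathcomp Require Import all_classical all_reals all_analysis.

Set Implicit Arguments.
Unset Strict Implicit.
Unset Printing Implicit Defensive.

Import Order.TTheory GRing.Theory Num.Theory.
Import numFieldNormedType.Exports.

Local Open Scope classical_set_scope.
Local Open Scope ring_scope.

(** The sigma-algebra on [R^d] generated by the coordinates, i.e. the Borel
    sigma-algebra (same construction as the library's one on tuples). *)
Section measurable_colvec.
Context (R : realType) (d : nat).

Let coord (i : 'I_d) (v : 'cV[R]_d) : R := v i 0.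

Let colvec_set0 : g_sigma_preimage coord set0.
Proof. exact: sigma_algebra0. Qed.

Let colvec_setC A : g_sigma_preimage coord A -> g_sigma_preimage coord (~` A).
Proof. exact: sigma_algebraC. Qed.

Let colvec_bigcup (F : (set 'cV[R]_d)^nat) :
  (forall i, g_sigma_preimage coord (F i)) ->
  g_sigma_preimage coord (\bigcup_i F i).
Proof. exact: sigma_algebra_bigcup. Qed.

HB.instance Definition _ := @isMeasurable.Build default_measure_display
  'cV[R]_d (g_sigma_preimage coord) colvec_set0 colvec_setC colvec_bigcup.

End measurable_colvec.

(** Euclidean geometry of [R^d]; the library norm on matrices is the sup norm,
    hence the separate [enorm]. *)
Section euclidean.
Context (R : realType) (d : nat).
Implicit Types u v w : 'cV[R]_d.

Definition dotv u w : R := (u^T *m w) 0 0.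

Definition enorm v : R := Num.sqrt (dotv v v).

Definition usphere : set 'cV[R]_d := [set v | enorm v = 1].

Definition normalize w : 'cV[R]_d := (enorm w)^-1 *: w.

Definition angle u w : R := acos (dotv u w).

(** [tan^2] of the angle, with the value [+oo] at a right angle, where the
    library's real-valued [tan] is [0] by convention. *)
Definition tan2_angle u w : \bar R :=
  if cos (angle u w) == 0 then +oo%E else ((tan (angle u w)) ^+ 2)%:E.

Definition psdmx (M : 'M[R]_d) : Prop :=
  M^T = M /\ forall v, 0 <= dotv v (M *m v).

End euclidean.

Section spectrum.
Context (R : realType).

(** [lambda_k], numbered from [k = 1]. *)
Definition ev d (lam : d.-tuple R) (k : nat) : R := nth 0 lam k.-1.

Definition pca_spectrum d (lam : d.-tuple R) : Prop :=
  [/\ (2 <= d)%N, ev lam 2 < ev lam 1,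
      forall k, (2 <= k < d)%N -> ev lam k.+1 <= ev lam k
    & 0 <= ev lam d].

(** [lam] lists the eigenvalues of [M], with multiplicity. *)
Definition has_spectrum d (M : 'M[R]_d) (lam : d.-tuple R) : Prop :=
  char_poly M = \prod_(l <- lam) ('X - l%:P).

Definition gap d (lam : d.-tuple R) : R := ev lam 1 - ev lam 2.

(** [sum_{k=2}^d lambda_k / (lambda_1 - lambda_k)] *)
Definition spectral_sum d (lam : d.-tuple R) : R :=
  \sum_(2 <= k < d.+1) ev lam k / (ev lam 1 - ev lam k).

End spectrum.

Section probability_notions.
Context (R : realType).

(** [sup_{p >= 1} p^(-1/2) (E |Y|^p)^(1/p)] *)
Definition psi2_norm d (T : measurableType d) (P : probability T R)
    (Y : T -> R) : \bar R :=
  ereal_sup [set ((p `^ (- 2^-1))%:E * 'N[P]_(p%:E)[EFin \o Y])%E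
            | p in [set p : R | 1 <= p]].

Definition mutually_independent d (T : measurableType d) d'
    (T' : measurableType d') (P : probability T R)
    (X : nat -> {RV P >-> T'}) : Prop :=
  forall (s : seq nat) (B : nat -> set T'), uniq s ->
    (forall n, measurable (B n)) ->
    P (\bigcap_(n in [set` s]) (X n @^-1` B n)) =
    (\prod_(n <- s) P (X n @^-1` B n))%E.

(** [U] is independent of the sigma-algebra generated by all the [X n]. *)
Definition independent_of_seq d (T : measurableType d) d'
    (T' : measurableType d') (P : probability T R)
    (U : {RV P >-> T'}) (X : nat -> {RV P >-> T'}) : Prop :=
  forall (B : set T') (E : set T), measurable B ->
    <<s [set F | exists n B', measurable B' /\ F = X n @^-1` B'] >> E ->
    P (U @^-1` B `&` E) = (P (U @^-1` B) * P E)%E.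

(** The uniform distribution on the unit sphere: the (unique) probability
    measure carried by the sphere and invariant under the orthogonal group. *)
Definition uniform_on_sphere d (mu : probability 'cV[R]_d R) : Prop :=
  mu (@usphere R d) = 1%E /\
  forall Q : 'M[R]_d, Q^T *m Q = 1%:M ->
    forall B, measurable B -> mu [set v | B (Q *m v)] = mu B.

(** [E Z = 0], [E (Z Z^T) = I] and
    [sup_{|v| = 1} || v^T Z ||_psi2 <= 1]; since the library's integral of a
    function with infinite positive and negative parts is [-oo], the first
    condition includes the integrability of the coordinates. *)
Definition standardized_subgaussian dZ (T : measurableType dZ)
    (P : probability T R) d (Z : {RV P >-> 'cV[R]_d}) : Prop :=
  [/\ forall i, ('E_P[fun w => (Z w i 0)%R] = 0)%E,
      forall i j, ('E_P[fun w => (Z w i 0 * Z w j 0)%R] = ((i == j)%:R)%:E)%E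
    & (ereal_sup [set psi2_norm P (fun w => dotv v (Z w)) | v in @usphere R d]
        <= 1)%E].

(** [X] is a sequence of i.i.d. copies of [M *m Z]. *)
Definition iid_copies dZ (TZ : measurableType dZ) (PZ : probability TZ R)
    dX (TX : measurableType dX) (P : probability TX R) d (M : 'M[R]_d)
    (Z : {RV PZ >-> 'cV[R]_d}) (X : nat -> {RV P >-> 'cV[R]_d}) : Prop :=
  mutually_independent X /\
  forall n B, measurable B ->
    distribution P (X n) B = PZ [set w | B (M *m Z w)].

End probability_notions.

Section algorithm.
Context (R : realType).

(** The [n]-th iterate [u^(n)]; [x n] is the sample numbered [n + 1]. *)
Fixpoint online_pca d (beta : R) (x : nat -> 'cV[R]_d) (u0 : 'cV[R]_d)
    (n : nat) : 'cV[R]_d :=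
  if n is m.+1 then
    let u := online_pca beta x u0 m in
    normalize (u + beta *: (x m *m (x m)^T *m u))
  else u0.

Definition rescaled_time d (lam : d.-tuple R) (beta s : R) : int :=
  Num.ceil (s * ln ((ev lam 1) ^- 2 * gap lam * beta^-1) /
            - ln (1 - beta * gap lam)).

Definition stepsize d (lam : d.-tuple R) (N : nat) : R :=
  2 * ln N%:R / (gap lam * N%:R).

(** [lambda_1^2 (lambda_1 - lambda_2)^-1 beta] for the above stepsize *)
Definition rescaled_stepsize d (lam : d.-tuple R) (N : nat) : R :=
  (ev lam 1) ^+ 2 * (gap lam)^-1 * stepsize lam N.

Definition condA (b3 eps0 : R) d (lam : d.-tuple R) (N : nat) (delta : R) :
    Prop :=
  d%:R * rescaled_stepsize lam N `^ (1 - 2 * eps0) <= b3 * delta ^+ 2.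

Definition condB (C6 eps0 : R) d (lam : d.-tuple R) (N : nat) (delta : R) :
    Prop :=
  4 * d%:R * (rescaled_time lam (stepsize lam N) 2)%:~R *
    expR (- C6 * rescaled_stepsize lam N `^ (- (2 * eps0))) <= delta.

End algorithm.

(* Main.v *)
Require Import Defs.
From HB Require Import structures.
From mathcomp Require Import all_boot all_order all_algebra.
From mathcomp Require Import all_classical all_reals all_analysis.
From mathcomp Require Import measurable_realfun ring lra.
Set Implicit Arguments.
Unset Strict Implicit.
Unset Printing Implicit Defensive.
Import Order.TTheory GRing.Theory Num.Theory.
Import numFieldNormedType.Exports.
Local Open Scope classical_set_scope.
Local Open Scope ring_scope.

(** Without the normalization, and after division by [<u_0, u*>] and by
    [(1 + beta lambda_1)^t], the iterates become a linear Markov chain [v_t] with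
    [tan^2 angle(u*, u_t) = sum_(k >= 2) <v_t, e_k>^2 / <v_t, u*>^2].  The
    fourth moment case of the [psi_2] bound suffices: with
    [rho_k = (1 + beta lambda_k) / (1 + beta lambda_1)], [q_k = E <v_t, e_k>^2]
    and [S = sum_j lambda_j q_j], one step gives
    [q_k' <= rho_k^2 q_k + 16 beta^2 lambda_k S], while [<v_t, u*>] is a
    martingale started at [1] whose variance grows by at most
    [16 beta^2 lambda_1 S].  The initial energy is finite after truncating
    [<u_0, u*>^2] at [y = (delta / 30)^2 / d], since
    [E 1 / (y + <u_0, u*>^2) <= 15 sqrt (d / y)] on the sphere; the truncation
    costs probability [delta].  Conditions (A) and (B) keep the variance below
    [delta / 4] up to time [N], so [<v_N, u*> >= 1 / 2] outside probability
    [delta], and there [tan^2 <= 4 sum_(k >= 2) <v_N, e_k>^2]. *)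

(** The truncation is forced by the factor 1 / <u_0, u*>: this coordinate has a positive density
    near 0, so its inverse square has infinite mean. The uniform law is given only by its invariance
    under the orthogonal group, so the bound of order sqrt (d / y) is obtained without a density, by
    comparing a smoothed sign of one coordinate under two nearby reflections. An update is quadratic
    in the sample, so its second moment needs fourth moments; p = 4 in the psi_2 bound gives E Y^4
    <= 16, the origin of the factor 16. Condition (B) serves only to give log N <= 2 r^(-2 eps0),
    where r is [rescaled_stepsize]. With (A) this yields d r log N <= 2 b3 delta^2, which controls
    the noise accumulated over N steps. The stepsize satisfies beta (lambda_1 - lambda_2) N = 2 log
    N, so an initial energy of at most N is damped by N^(-3). What remains is at most 4 / N and is
    absorbed in the factors, which equal C_5 exactly as soon as the main term is at least 1 / N. *)

Section dot_product.
Context (R : realType) (n : nat).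
Implicit Types (u v w : 'cV[R]_n) (M : 'M[R]_n) (a : R).

Lemma dotvE u v : dotv u v = \sum_i u i 0 * v i 0.
Proof. by rewrite /dotv mxE; apply: eq_bigr => i _; rewrite mxE. Qed.

Lemma dotvC u v : dotv u v = dotv v u.
Proof. by rewrite !dotvE; apply: eq_bigr => i _; rewrite mulrC. Qed.

Lemma dotvDr u v w : dotv u (v + w) = dotv u v + dotv u w.
Proof. by rewrite /dotv mulmxDr mxE. Qed.

Lemma dotvBr u v w : dotv u (v - w) = dotv u v - dotv u w.
Proof. by rewrite /dotv mulmxBr !mxE. Qed.

Lemma dotvZr a u v : dotv u (a *: v) = a * dotv u v.
Proof. by rewrite /dotv -scalemxAr mxE. Qed.

Lemma dotvBl u v w : dotv (v - w) u = dotv v u - dotv w u.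
Proof. by rewrite dotvC dotvBr !(dotvC u). Qed.

Lemma dotvZl a u v : dotv (a *: v) u = a * dotv v u.
Proof. by rewrite dotvC dotvZr dotvC. Qed.

Lemma dotv0r u : dotv u 0 = 0.
Proof. by rewrite /dotv mulmx0 mxE. Qed.

Lemma dotv0l u : dotv 0 u = 0.
Proof. by rewrite dotvC dotv0r. Qed.

Lemma dotv_ge0 u : 0 <= dotv u u.
Proof. by rewrite dotvE sumr_ge0 // => i _; rewrite -expr2 sqr_ge0. Qed.

Lemma dotv_eq0 u : (dotv u u == 0) = (u == 0).
Proof.
apply/eqP/eqP => [|->]; last by rewrite dotv0r.
rewrite dotvE => /eqP; rewrite psumr_eq0 => [/allP h|i _]; last first.
  by rewrite -expr2 sqr_ge0.
apply/matrixP => i j; rewrite (ord1 j) mxE.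
by have /implyP/(_ isT) := h i (mem_index_enum i); rewrite mulf_eq0 orbb => /eqP.
Qed.

Lemma sqr_enorm u : enorm u ^+ 2 = dotv u u.
Proof. by rewrite sqr_sqrtr // dotv_ge0. Qed.

Lemma enorm_eq1 u : (enorm u = 1) <-> (dotv u u = 1).
Proof.
split=> [h|h]; first by rewrite -sqr_enorm h expr1n.
by rewrite /enorm h sqrtr1.
Qed.

Lemma dotv_mulmxr u M v : dotv u (M *m v) = dotv (M^T *m u) v.
Proof. by rewrite /dotv trmx_mul trmxK mulmxA. Qed.

Lemma mul_outer v u : v *m v^T *m u = dotv v u *: v.
Proof. by rewrite -mulmxA [_ *m u]mx11_scalar mul_mx_scalar. Qed.

Lemma dotv_orthogonal (Q : 'M[R]_n) u v :
  Q^T *m Q = 1%:M -> dotv (Q *m u) (Q *m v) = dotv u v.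
Proof. by move=> h; rewrite dotv_mulmxr mulmxA h mul1mx. Qed.

(* With [c * |v|^2 = 2] this is the reflection in the hyperplane orthogonal to
   [v], with [c = 0] it is the identity. *)
Definition reflection (c : R) v : 'M[R]_n := 1%:M - c *: (v *m v^T).

Lemma reflectionE c v u : reflection c v *m u = u - (c * dotv v u) *: v.
Proof. by rewrite mulmxBl mul1mx -scalemxAl mul_outer scalerA. Qed.

Lemma trmx_reflection c v : (reflection c v)^T = reflection c v.
Proof.
by rewrite /reflection linearB /= trmx1 linearZ /= trmx_mul trmxK.
Qed.

Lemma reflectionK c v : c * (c * dotv v v - 2) = 0 ->
  reflection c v *m reflection c v = 1%:M.
Proof.
move=> h; rewrite {1}/reflection mulmxBl mul1mx -scalemxAl.
suff -> : v *m v^T *m reflection c v = (1 - c * dotv v v) *: (v *m v^T).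
  rewrite scalerA /reflection -addrA -opprD -scalerDl.
  have -> : c + c * (1 - c * dotv v v) = 0.
    by rewrite -[LHS]opprK -[RHS]oppr0 -h; congr (- _); ring.
  by rewrite scale0r subr0.
rewrite mulmxBr mulmx1 scalerBl scale1r -scalemxAr; congr (_ - _).
by rewrite mulmxA mul_outer -scalemxAl scalerA.
Qed.

End dot_product.

(** * Spectral theorem with a prescribed leading eigenvector *)

Section spectral_theorem.
Context (R : realType).

(** For unit vectors |u - v|^2 = 2 (1 - <u, v>), so the reflection along u - v, with coefficient 1 /
    (1 - <u, v>), exchanges them. Being symmetric and involutive, it is its own inverse in a change
    of basis. *)
Lemma reflection_to n (u v : 'cV[R]_n) : dotv u u = 1 -> dotv v v = 1 ->
  exists H : 'M[R]_n, [/\ H^T = H, H *m H = 1%:M, H *m u = v & H *m v = u].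
Proof.
move=> uu vv; have [->|neq] := eqVneq u v.
  by exists 1%:M; rewrite trmx1 !mul1mx.
have w0 : dotv (u - v) (u - v) != 0 by rewrite dotv_eq0 subr_eq0.
have ww : dotv (u - v) (u - v) = 2 * (1 - dotv u v).
  by rewrite !(dotvBl, dotvBr) uu vv (dotvC v u); ring.
have c0 : 1 - dotv u v != 0.
  by apply: contra_neq w0 => h; rewrite ww h mulr0.
pose c := (1 - dotv u v)^-1; exists (reflection c (u - v)).
rewrite trmx_reflection reflectionK; last first.
  by rewrite ww /c; field.
rewrite !reflectionE !(dotvBl, dotvBr) uu vv (dotvC v u).
rewrite -(opprB 1 (dotv u v)) mulrN mulVf // scaleN1r opprK scale1r.
by split=> //; rewrite ?subKr // addrC subrK.
Qed.

Lemma char_poly_conj n (H S : 'M[R]_n) : H *m H = 1%:M ->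
  char_poly (H *m S *m H) = char_poly S.
Proof.
move=> HH; pose h := map_mx (@polyC R) H.
have hh : h *m h = 1%:M by rewrite -map_mxM HH map_mx1.
rewrite /char_poly /char_poly_mx.
have -> : 'X%:M - map_mx polyC (H *m S *m H) =
    h *m ('X%:M - map_mx polyC S) *m h.
  by rewrite mulmxBr mulmxBl !map_mxM -/h scalar_mxC -!mulmxA hh mulmx1.
rewrite !det_mulmx mulrAC -det_mulmx hh det1 mul1r //.
Qed.

Lemma char_poly_block_scalar n (l : R) (S : 'M[R]_n) :
  char_poly (block_mx l%:M 0 0 S : 'M[R]_(1 + n)) = ('X - l%:P) * char_poly S.
Proof.
rewrite /char_poly char_block_diag_mx det_ublock det_mx11; congr (_ * _).
by rewrite !mxE eqxx !mulr1n.
Qed.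

Definition diagonalized n (S : 'M[R]_n) (s : seq R) (O : 'M[R]_n) :=
  O^T *m O = 1%:M /\ forall k : 'I_n, S *m col k O = s`_k *: col k O.

(* Deflation by the reflection that exchanges [u] with the first basis vector. *)
Lemma deflation m (S : 'M[R]_m.+1) l s u :
  S^T = S -> char_poly S = \prod_(x <- l :: s) ('X - x%:P) ->
  dotv u u = 1 -> S *m u = l *: u ->
  (forall S' : 'M[R]_m, S'^T = S' ->
     char_poly S' = \prod_(x <- s) ('X - x%:P) ->
     exists W, diagonalized S' s W) ->
  exists O, diagonalized S (l :: s) O /\ col 0 O = u.
Proof.
move=> SS cS uu Su IH.
pose e : 'cV[R]_(1 + m) := delta_mx 0 0.
have ee : dotv e e = 1.
  rewrite dotvE (bigD1 0) //= big1 => [|i ne]; rewrite !mxE ?eqxx ?mulr1 ?addr0 //.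
  by rewrite (negbTE ne) mul0r.
have [H [HT HH He Hu]] := reflection_to ee uu.
pose T : 'M[R]_(1 + m) := H *m S *m H.
have TT : T^T = T by rewrite /T !trmx_mul HT SS mulmxA.
have Te : T *m e = l *: e by rewrite /T -mulmxA He -mulmxA Su -scalemxAr Hu.
(* [T] maps [e] to a multiple of itself and is symmetric, so it splits into the corner [l] and a
   smaller symmetric block. *)
have Tcol : col 0 T = l *: e by rewrite colE.
have dlT : dlsubmx T = 0.
  apply/matrixP => i j; rewrite (ord1 j) !mxE.
  have := congr1 (fun M : 'cV[R]_(1 + m) => M (rshift 1 i) 0) Tcol.
  rewrite !mxE /= => h.
  have -> : lshift m 0 = 0 :> 'I_(1 + m) by apply/val_inj.
  by rewrite h mulr0.
have urT : ursubmx T = 0.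
  by apply: trmx_inj; rewrite trmx0 trmx_ursub TT dlT.
have ulT : ulsubmx T = l%:M.
  apply/matrixP => i j; rewrite !ord1 !mxE.
  have := congr1 (fun M : 'cV[R]_(1 + m) => M 0 0) Tcol.
  rewrite !mxE eqxx mulr1 => h.
  by rewrite (_ : lshift m 0 = 0) //; apply/val_inj.
have eT : T = block_mx l%:M 0 0 (drsubmx T).
  by rewrite -[T in LHS]submxK ulT urT dlT.
have SS' : (drsubmx T)^T = drsubmx T by rewrite trmx_drsub TT.
have cS' : char_poly (drsubmx T) = \prod_(x <- s) ('X - x%:P).
  apply: (mulfI (negbT (polyXsubC_eq0 l))).
  by rewrite -char_poly_block_scalar -eT /T char_poly_conj // cS big_cons.
have [W [WW SW]] := IH _ SS' cS'.
pose B : 'M[R]_(1 + m) := block_mx 1%:M 0 0 W.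
have BB : B^T *m B = 1%:M.
  rewrite /B tr_block_mx mulmx_block !trmx0 trmx1 !mulmx0 !mul0mx !addr0 add0r.
  by rewrite mul1mx WW -scalar_mx_block.
have TB (k : 'I_(1 + m)) : T *m col k B = (l :: s)`_k *: col k B.
  have col0 p (j : 'I_p) : col j (0 : 'M[R]_(_, p)) = 0 :> 'cV[R]_m.
    by apply/matrixP => a b; rewrite !mxE.
  have col0' p (j : 'I_p) : col j (0 : 'M[R]_(_, p)) = 0 :> 'cV[R]_1.
    by apply/matrixP => a b; rewrite !mxE.
  case: (split_ordP k) => j ->; rewrite /B block_mxEh ?colKl ?colKr col_col_mx.
    rewrite (ord1 j) col0 eT mul_block_col !mulmx0 mul0mx !addr0.
    by rewrite mul_scalar_mx scale_col_mx scaler0.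
  rewrite col0' eT mul_block_col !mulmx0 mul0mx !add0r SW.
  by rewrite scale_col_mx scaler0.
exists (H *m B); split; last first.
  rewrite colE -mulmxA -/e.
  have -> : B *m e = e.
    rewrite /B /e -colE.
    have -> : 0 = lshift m 0 :> 'I_(1 + m) by apply/val_inj.
    rewrite block_mxEh colKl.
    apply/matrixP => i j; rewrite !mxE.
    have -> : (i == lshift m 0) = (i == 0 :> nat) by rewrite -val_eqE.
    by case: splitP => a ->; rewrite ?ord1 mxE ?ord1.
  by [].
split; first by rewrite trmx_mul HT mulmxA -(mulmxA _ H H) HH mulmx1 BB.
move=> k; have -> : col k (H *m B) = H *m col k B by rewrite !colE mulmxA.
have -> : S *m (H *m col k B) = H *m (T *m col k B).
  by rewrite /T !mulmxA HH mul1mx.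
by rewrite TB -scalemxAr.
Qed.

(** The characteristic polynomial is assumed to split, so the head of [s] is an eigenvalue, and a
    unit eigenvector for it drives the deflation. An empty list would contradict the degree of the
    polynomial. *)
Lemma spectral_theorem n (S : 'M[R]_n) (s : seq R) :
  S^T = S -> char_poly S = \prod_(x <- s) ('X - x%:P) ->
  exists O, diagonalized S s O.
Proof.
elim: n S s => [|n IH] S s SS cS.
  by exists 1%:M; split=> [|[]//]; rewrite trmx1 mul1mx.
case: s cS => [|l s] cS.
  have := size_char_poly S; rewrite cS big_nil size_poly1 //.
have : eigenvalue S l.
  by rewrite eigenvalue_root_char cS big_cons rootM root_XsubC eqxx.
case/eigenvalueP => v vS v0; pose u := normalize v^T.
have vv : dotv v^T v^T != 0 by rewrite dotv_eq0 -trmx0 (inj_eq (@trmx_inj _ _ _)).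
have uu : dotv u u = 1.
  rewrite /u /normalize dotvZl dotvZr mulrA -invfM -expr2 sqr_enorm mulVf //.
have Su : S *m u = l *: u.
  rewrite -scalemxAr -{1}SS -trmx_mul vS linearZ /= !scalerA mulrC //.
have [V [h _]] := deflation SS cS uu Su (fun S' => IH S' s).
by exists V.
Qed.

(** Angles are measured from the given eigenvector, so the basis has to begin with it; only the
    first deflation is prescribed. *)
Lemma spectral_theorem_prescribed n (S : 'M[R]_n.+1) (s : seq R) u :
  S^T = S -> char_poly S = \prod_(x <- s) ('X - x%:P) ->
  dotv u u = 1 -> S *m u = s`_0 *: u ->
  exists O, diagonalized S s O /\ col 0 O = u.
Proof.
case: s => [|l s] SS cS uu Su; last first.
  by apply: deflation => // S'; apply: spectral_theorem.
by have := size_char_poly S; rewrite cS big_nil size_poly1.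
Qed.

End spectral_theorem.

Section orthonormal_bases.
Context (R : realType).

(** The second clause is completeness, in the form of Parseval's identity. *)
Definition orthonormal_basis n (e : 'I_n -> 'cV[R]_n) :=
  (forall i j, dotv (e i) (e j) = (i == j)%:R) /\
  (forall v w, dotv v w = \sum_k dotv (e k) v * dotv (e k) w).

Lemma orthonormal_basis_col n (V : 'M[R]_n) :
  V^T *m V = 1%:M -> orthonormal_basis (fun k => col k V).
Proof.
move=> VV; split=> [i j|v w].
  rewrite !colE dotv_orthogonal // dotvE (bigD1 i) //= big1 => [|k ki].
    by rewrite !mxE !eqxx mul1r addr0 /= andbT.
  by rewrite !mxE (negbTE ki) mul0r.
have VV' : V *m V^T = 1%:M by apply: mulmx1C.
rewrite -[in LHS](mul1mx w) -VV' -mulmxA dotv_mulmxr dotvE.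
apply: eq_bigr => k _; rewrite ![dotv (col _ _) _]dotvE !mxE.
by congr (_ * _); apply: eq_bigr => j _; rewrite !mxE.
Qed.

Lemma eigenbasis n (S : 'M[R]_n.+1) (s : seq R) u :
  S^T = S -> char_poly S = \prod_(x <- s) ('X - x%:P) ->
  dotv u u = 1 -> S *m u = s`_0 *: u ->
  exists e, [/\ orthonormal_basis e, e 0 = u &
    forall k : 'I_n.+1, S *m e k = s`_k *: e k].
Proof.
move=> SS cS uu Su.
have [V [[VV SV] Vu]] := spectral_theorem_prescribed SS cS uu Su.
by exists (fun k => col k V); split=> //; apply: orthonormal_basis_col.
Qed.

End orthonormal_bases.

(** * Measurability, and integrals of nonnegative real functions *)

Section measurability.
Context (R : realType) (n : nat) (d : measure_display) (T : measurableType d).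
Implicit Types f g : T -> 'cV[R]_n.

Lemma measurable_coord (i : 'I_n) :
  measurable_fun [set: 'cV[R]_n] (fun v => v i 0).
Proof.
move=> _ Y mY; rewrite setTI; apply: sub_sigma_algebra => /=.
rewrite -bigcup_seq/=; exists i => /=; first by rewrite mem_index_enum.
by exists Y => //; rewrite setTI.
Qed.

Lemma measurable_colvec f :
  (forall i, measurable_fun [set: T] (fun x => f x i 0)) ->
  measurable_fun [set: T] f.
Proof.
move=> mf _ A mA; rewrite setTI.
suff : g_sigma_preimage (fun i (v : 'cV[R]_n) => v i 0) `<=`
    [set B | measurable (f @^-1` B)] by exact.
apply: smallest_sub.
  split=> /=.
  - by rewrite preimage_set0; exact: measurable0.
  - by move=> B mB; rewrite setTD preimage_setC; exact: measurableC.
  - by move=> F mF; rewrite preimage_bigcup; exact: bigcup_measurable.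
rewrite -bigcup_seq; apply: bigcup_sub => i _ B [Y mY <-] /=.
by rewrite setTI -[X in measurable X]setTI; exact: mf.
Qed.

Lemma measurable_coordT f i : measurable_fun [set: T] f ->
  measurable_fun [set: T] (fun x => f x i 0).
Proof. by move=> mf; exact: measurableT_comp (measurable_coord i) mf. Qed.

Lemma measurable_dotv f g : measurable_fun [set: T] f ->
  measurable_fun [set: T] g -> measurable_fun [set: T] (fun x => dotv (f x) (g x)).
Proof.
move=> mf mg; under eq_fun do rewrite dotvE.
by apply: measurable_sum => i; apply: measurable_funM; exact: measurable_coordT.
Qed.

Lemma measurable_mulmx (M : 'M[R]_n) f : measurable_fun [set: T] f ->
  measurable_fun [set: T] (fun x => M *m f x).
Proof.
move=> mf; apply: measurable_colvec => i; under eq_fun do rewrite mxE.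
by apply: measurable_sum => j; apply: measurable_funM => //; exact: measurable_coordT.
Qed.

Lemma measurable_scalev (a : T -> R) f : measurable_fun [set: T] a ->
  measurable_fun [set: T] f -> measurable_fun [set: T] (fun x => a x *: f x).
Proof.
move=> ma mf; apply: measurable_colvec => i; under eq_fun do rewrite mxE.
by apply: measurable_funM => //; exact: measurable_coordT.
Qed.

Lemma measurable_addv f g : measurable_fun [set: T] f ->
  measurable_fun [set: T] g -> measurable_fun [set: T] (fun x => f x + g x).
Proof.
move=> mf mg; apply: measurable_colvec => i; under eq_fun do rewrite mxE.
by apply: measurable_funD; exact: measurable_coordT.
Qed.

(** 1 / a is written as a (a^2)^(-1), a real power of a nonnegative base; where a = 0 both sides
    vanish, the inverse of 0 being 0. *)
Lemma measurable_invr (a : T -> R) : measurable_fun [set: T] a ->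
  measurable_fun [set: T] (fun x => (a x)^-1).
Proof.
move=> ma; have -> : (fun x => (a x)^-1) = (fun x => a x * (a x ^+ 2) `^ (-1)).
  apply/funext => x; rewrite powR_inv1 ?sqr_ge0 // expr2 invfM.
  by have [->|ax] := eqVneq (a x) 0; rewrite ?invr0 ?mul0r // mulrA mulfV ?mul1r.
apply: measurable_funM => //.
apply: (measurableT_comp (@measurable_powR R (-1))).
exact: measurable_funX.
Qed.

End measurability.

Lemma measurable_usphere (R : realType) n : measurable (@usphere R n).
Proof.
have -> : @usphere R n = [set: 'cV[R]_n] `&` (fun v => dotv v v) @^-1` [set 1].
  by rewrite setTI; apply/seteqP; split=> v /= /enorm_eq1.
by apply: measurable_dotv => //; exact: measurable_id.
Qed.

Section nonnegative_real_integrands.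
Context (R : realType) (d : measure_display) (T : measurableType d).
Context (mu : {measure set T -> \bar R}) (D : set T).
Hypothesis mD : measurable D.
Implicit Types f g : T -> R.

Lemma nnr_integralD f g : measurable_fun D f -> measurable_fun D g ->
  (forall x, D x -> 0 <= f x) -> (forall x, D x -> 0 <= g x) ->
  (\int[mu]_(x in D) (f x + g x)%:E =
   \int[mu]_(x in D) (f x)%:E + \int[mu]_(x in D) (g x)%:E)%E.
Proof.
move=> mf mg f0 g0; under eq_integral do rewrite EFinD.
by rewrite ge0_integralD //; do ?[exact/measurable_EFinP];
  move=> x Dx; rewrite lee_fin; auto.
Qed.

Lemma nnr_integralZl k f : 0 <= k -> measurable_fun D f ->
  (forall x, D x -> 0 <= f x) ->
  (\int[mu]_(x in D) (k * f x)%:E = k%:E * \int[mu]_(x in D) (f x)%:E)%E.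
Proof.
move=> k0 mf f0; under eq_integral do rewrite EFinM.
by rewrite ge0_integralZl_EFin //; do ?[exact/measurable_EFinP];
  move=> x Dx; rewrite lee_fin; auto.
Qed.

Lemma nnr_le_integral f g : measurable_fun D f -> measurable_fun D g ->
  (forall x, D x -> 0 <= f x) -> (forall x, D x -> f x <= g x) ->
  (\int[mu]_(x in D) (f x)%:E <= \int[mu]_(x in D) (g x)%:E)%E.
Proof.
move=> mf mg f0 fg; apply: ge0_le_integral => //;
  do ?[exact/measurable_EFinP]; move=> x Dx; rewrite lee_fin; auto.
Qed.

Lemma nnr_integral_sum n (P : pred 'I_n) (f : 'I_n -> T -> R) :
  (forall i, measurable_fun D (f i)) -> (forall i x, D x -> 0 <= f i x) ->
  (\int[mu]_(x in D) (\sum_(i | P i) f i x)%:E =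
   \sum_(i | P i) \int[mu]_(x in D) (f i x)%:E)%E.
Proof.
move=> mf f0; under eq_integral do rewrite -sumEFin -big_filter.
rewrite ge0_integral_sum ?big_filter //; first by move=> i; exact/measurable_EFinP.
Qed.

Lemma nnr_integral_cst k :
  (\int[mu]_(x in D) k%:E = k%:E * mu D)%E.
Proof. exact: integral_cst. Qed.

End nonnegative_real_integrands.

(** * Inverse moment of a coordinate under the uniform law on the sphere *)

Section plane_reflections.
Context (R : realType) (n : nat) (e : 'I_n -> 'cV[R]_n).
Hypothesis basis_e : orthonormal_basis e.

(** The reflection along w = (1 - C) e_a - S e_b, with |w|^2 = 2 (1 - C), has rows (C, S) and (S,
    -C) in the plane of e_a and e_b. It takes the role of a rotation by a small angle. *)
Lemma plane_reflection (C S : R) (a b : 'I_n) :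
  a != b -> C ^+ 2 + S ^+ 2 = 1 -> C != 1 -> exists H : 'M[R]_n,
  [/\ H^T *m H = 1%:M,
      forall x, dotv (e a) (H *m x) = C * dotv (e a) x + S * dotv (e b) x &
      forall x, dotv (e b) (H *m x) = S * dotv (e a) x - C * dotv (e b) x].
Proof.
case: basis_e => ee _ ab CS C1.
have C1' : 1 - C != 0 by rewrite subr_eq0 eq_sym.
pose w := (1 - C) *: e a - S *: e b.
have wa : dotv (e a) w = 1 - C.
  by rewrite /w !(dotvBr, dotvZr) !ee eqxx (negbTE ab) mulr1 mulr0 subr0.
have wb : dotv (e b) w = - S.
  by rewrite /w !(dotvBr, dotvZr) !ee eqxx eq_sym (negbTE ab) mulr1 mulr0 sub0r.
have ww : dotv w w = 2 * (1 - C).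
  rewrite {1}/w dotvBl !dotvZl wa wb.
  by rewrite mulrN opprK -!expr2 -[S ^+ 2](addKr (C ^+ 2)) CS; ring.
exists (reflection (1 - C)^-1 w); split=> [|x|x].
- by rewrite trmx_reflection reflectionK // ww; field.
- rewrite reflectionE dotvBr dotvZr wa {1}/w dotvBl !dotvZl; field.
  exact: C1'.
- rewrite reflectionE dotvBr dotvZr wb {1}/w dotvBl !dotvZl.
  have SS : S ^+ 2 = (1 - C) * (1 + C).
    by rewrite -[S ^+ 2](addKr (C ^+ 2)) CS; ring.
  rewrite [LHS](_ : _ = S * dotv (e a) x +
    (1 - S ^+ 2 / (1 - C)) * dotv (e b) x); last by field.
  by rewrite SS; field.
Qed.

End plane_reflections.

Section rotation_inequality.
Context (R : realFieldType).
Implicit Types p q x y C S : R.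

(** A smoothed sign: odd, bounded by 1, increasing with slope S / (S + |p|)^2. *)
Let phi S p := p / (S + `|p|).

Lemma phi_le1 S p : 0 < S -> `|phi S p| <= 1.
Proof.
move=> S0; have p0 := normr_ge0 p; rewrite normrM normfV.
rewrite (gtr0_norm (_ : 0 < S + `|p|)); last by lra.
by rewrite ler_pdivrMr ?mul1r; lra.
Qed.

(** Equality holds for p and q of the same sign; opposite signs only enlarge the right side, through
    |p| |q| - p q >= 0. *)
Lemma phi_increment S p q : 0 < S ->
  S * (p - q) ^+ 2 / ((S + `|p|) * (S + `|q|)) <= (phi S p - phi S q) * (p - q).
Proof.
move=> S0; have p0 := normr_ge0 p; have q0 := normr_ge0 q.
have Sp : 0 < S + `|p| by lra.
have Sq : 0 < S + `|q| by lra.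
rewrite ler_pdivrMr ?mulr_gt0 //.
have -> : (phi S p - phi S q) * (p - q) * ((S + `|p|) * (S + `|q|)) =
    S * (p - q) ^+ 2 + (p - q) * (p * `|q| - q * `|p|).
  by rewrite /phi; field; rewrite !gt_eqF.
rewrite lerDl.
have -> : (p - q) * (p * `|q| - q * `|p|) =
    (`|p| + `|q|) * (`|p| * `|q| - p * q).
  have pp : p ^+ 2 = `|p| ^+ 2 by rewrite real_normK ?num_real.
  have qq : q ^+ 2 = `|q| ^+ 2 by rewrite real_normK ?num_real.
  rewrite [LHS](_ : _ = p ^+ 2 * `|q| + q ^+ 2 * `|p| - p * q * (`|p| + `|q|)).
    by rewrite pp qq; ring.
  by ring.
apply: mulr_ge0; first exact: addr_ge0.
by rewrite subr_ge0 -normrM ler_norm.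
Qed.

(** The two products differ by S x (phi p + phi q) - C y (phi p - phi q). The first part is at most
    2 S |x|. Since p - q = 2 S y, [phi_increment] bounds y (phi p - phi q) from below, with S + |p|
    and S + |q| at most 2 S + |x|. *)
Lemma rotation_inequality C S x y : 0 < S -> 0 < C -> C ^+ 2 + S ^+ 2 = 1 ->
  `|y| <= 1 ->
  1 + phi S (C * x + S * y) * (S * x - C * y) +
    2 * C * S ^+ 2 * y ^+ 2 / (2 * S + `|x|) ^+ 2 <=
  1 + phi S (C * x - S * y) * (- S * x - C * y) + 2 * S * `|x|.
Proof.
move=> S0 C0 CS y1; set p := C * x + S * y; set q := C * x - S * y.
have x0 := normr_ge0 x; have p0 := normr_ge0 p; have q0 := normr_ge0 q.
have C1 : C <= 1 by have := sqr_ge0 S; have := C0; nra.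
have aux : `|C * x| + `|S * y| <= S + `|x|.
  by rewrite !normrM (gtr0_norm C0) (gtr0_norm S0) addrC lerD //;
    [rewrite -[leRHS]mulr1 ler_pM2l | rewrite -[leRHS]mul1r ler_wpM2r].
have pb : S + `|p| <= 2 * S + `|x|.
  by have := ler_normD (C * x) (S * y); rewrite -/p; lra.
have qb : S + `|q| <= 2 * S + `|x|.
  by have := ler_normB (C * x) (S * y); rewrite -/q; lra.
have h1 : (phi S p + phi S q) * x <= 2 * `|x|.
  apply: le_trans (ler_norm _) _; rewrite normrM ler_wpM2r //.
  by apply: le_trans (ler_normD _ _) _; have := phi_le1 p S0;
    have := phi_le1 q S0; lra.
have h2 : 2 * S ^+ 2 * y ^+ 2 / (2 * S + `|x|) ^+ 2 <= (phi S p - phi S q) * y.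
  have h := phi_increment p q S0.
  have pq : p - q = 2 * S * y by rewrite /p /q; ring.
  rewrite pq in h.
  have S2 : 0 < 2 * S by lra.
  rewrite -(ler_pM2l S2).
  have -> : 2 * S * ((phi S p - phi S q) * y) = (phi S p - phi S q) * (2 * S * y).
    by ring.
  apply: le_trans h.
  have -> : 2 * S * (2 * S ^+ 2 * y ^+ 2 / (2 * S + `|x|) ^+ 2) =
    S * (2 * S * y) ^+ 2 / (2 * S + `|x|) ^+ 2 by ring.
  apply: ler_wpM2l; first by rewrite mulr_ge0 ?sqr_ge0 ?ltW.
  rewrite lef_pV2 ?posrE ?exprn_gt0 ?mulr_gt0 //; try by lra.
  by rewrite expr2; apply: ler_pM => //; lra.
have -> : 2 * C * S ^+ 2 * y ^+ 2 / (2 * S + `|x|) ^+ 2 =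
  C * (2 * S ^+ 2 * y ^+ 2 / (2 * S + `|x|) ^+ 2) by ring.
set A := _ / _ in h2 *.
have hC := ler_wpM2l (ltW C0) h2.
have hS := ler_wpM2l (ltW S0) h1.
lra.
Qed.

End rotation_inequality.

Section uniform_distribution.
Context (R : realType) (n : nat) (mu : probability 'cV[R]_n R).
Hypothesis mu_unif : uniform_on_sphere mu.
Local Notation S := (@usphere R n).

Lemma uniform_integral_orthogonal (Q : 'M[R]_n) (f : 'cV[R]_n -> R) :
  Q^T *m Q = 1%:M -> measurable_fun [set: 'cV[R]_n] f ->
  (forall x, S x -> 0 <= f x) ->
  (\int[mu]_(x in S) (f (Q *m x))%:E = \int[mu]_(x in S) (f x)%:E)%E.
Proof.
move=> QQ mf f0.
have mQ : measurable_fun setT (mulmx Q : 'cV[R]_n -> 'cV[R]_n).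
  by apply: measurable_mulmx; exact: measurable_id.
have SQ : (mulmx Q : 'cV[R]_n -> 'cV[R]_n) @^-1` S = S.
  by apply/seteqP; split=> x /= /enorm_eq1 h; apply/enorm_eq1;
    rewrite dotv_orthogonal in h *.
rewrite -[in LHS]SQ.
rewrite -(@ge0_integral_pushforward _ _ _ _ _ _ mQ mu S (EFin \o f)) //.
- apply: eq_measure_integral => A mA _.
  by case: mu_unif => _ /(_ Q QQ A mA).
- exact: measurable_usphere.
- by apply/measurable_EFinP; exact: measurable_funTS.
- by move=> x /[1!inE] Sx; rewrite lee_fin f0.
Qed.

Hypothesis (n0 : (0 < n)%N).
Context (e : 'I_n -> 'cV[R]_n).
Hypothesis basis_e : orthonormal_basis e.
Local Notation co k x := (dotv (e k) x).

Let mcoord k (D : set 'cV[R]_n) : measurable_fun D (fun x => (co k x)).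
Proof.
apply: measurable_funTS; apply: measurable_dotv => //; exact: measurable_id.
Qed.

Let coord_le1 k x : S x -> `|co k x| <= 1.
Proof.
move=> /enorm_eq1; case: basis_e => _ -> xx.
rewrite -(ler_pXn2r (n := 2)) ?nnegrE // expr1n real_normK ?num_real // -xx.
by rewrite (bigD1 k) //= expr2 lerDl sumr_ge0 // => i _; rewrite -expr2 sqr_ge0.
Qed.

(** The reflection with C = 0 and S = 1 exchanges two coordinates, so all second moments agree, and
    they sum to 1. *)
Lemma uniform_coord_sqr k : (\int[mu]_(x in S) ((co k x) ^+ 2)%:E = n%:R^-1%:E)%E.
Proof.
have mS := @measurable_usphere R n.
have sym a : (\int[mu]_(x in S) ((co a x) ^+ 2)%:E =
              \int[mu]_(x in S) ((co k x) ^+ 2)%:E)%E.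
  have [->//|ak] := eqVneq a k.
  have [||H [HH Ha _]] := @plane_reflection R n e basis_e 0 1 a k ak.
  - by rewrite expr0n expr1n add0r.
  - by rewrite eq_sym oner_eq0.
  rewrite -(@uniform_integral_orthogonal H) //.
  - by apply: eq_integral => x _; rewrite Ha mul0r mul1r add0r.
  - exact: measurable_funX.
  - by move=> x _; exact: sqr_ge0.
have : (\int[mu]_(x in S) (\sum_i (co i x) ^+ 2)%:E = 1)%E.
  under eq_integral => x /[1!inE] /enorm_eq1 xx.
    have -> : \sum_i (co i x) ^+ 2 = 1.
      by rewrite -xx; case: basis_e => _ ->; apply: eq_bigr => i _; rewrite expr2.
    over.
  by rewrite nnr_integral_cst // mul1e; case: mu_unif.
rewrite nnr_integral_sum // => [|i|i x _]; [|exact: measurable_funX|exact: sqr_ge0].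
rewrite (eq_bigr _ (fun i _ => sym i)).
set I := integral _ _ _.
have : (0 <= I)%E by apply: integral_ge0 => x _; rewrite lee_fin sqr_ge0.
case: I => [r||] // r0.
  rewrite sumEFin sumr_const card_ord => -[] h.
  congr EFin; apply: (mulIf (_ : n%:R != 0)); first by rewrite pnatr_eq0 -lt0n.
  by rewrite mulVf ?pnatr_eq0 -?lt0n // mulr_natr.
(* An infinite common value would make the sum infinite instead of 1. *)
case: (n) n0 => // m _; rewrite big_ord_recl /= addye //.
by rewrite gt_eqF // (lt_le_trans ltNy0) // sume_ge0.
Qed.

(** Pointwise |t| <= 1 / (2 s) + s t^2 / 2 with s = sqrt n, in place of the Cauchy-Schwarz
    inequality. *)
Lemma uniform_abs_coord k :
  (\int[mu]_(x in S) `|co k x|%:E <= (Num.sqrt n%:R)^-1%:E)%E.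
Proof.
have mS := @measurable_usphere R n.
set s := Num.sqrt n%:R; have s0 : 0 < s by rewrite sqrtr_gt0 ltr0n.
have ss : s ^+ 2 = n%:R by rewrite sqr_sqrtr // ler0n.
have -> : (s^-1%:E = \int[mu]_(x in S) (s^-1 / 2 + s / 2 * (co k x) ^+ 2)%:E)%E.
  rewrite nnr_integralD //.
  - rewrite nnr_integral_cst // nnr_integralZl //.
    + rewrite uniform_coord_sqr [X in (_ * X + _)%E](_ : _ = 1%E); last by case: mu_unif.
      rewrite mule1 -EFinM -EFinD.
      by congr EFin; rewrite -ss; field; rewrite gt_eqF.
    + by rewrite divr_ge0 // ltW.
    + exact: measurable_funX.
    + by move=> x _; exact: sqr_ge0.
  - by apply: measurable_funM => //; exact: measurable_funX.
  - by move=> x _; rewrite divr_ge0 // invr_ge0 ltW.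
  - by move=> x _; rewrite mulr_ge0 ?sqr_ge0 // divr_ge0 // ltW.
apply: nnr_le_integral => //.
- exact: measurableT_comp.
- apply: measurable_funD => //; apply: measurable_funM => //; exact: measurable_funX.
- move=> x _; rewrite -(ler_pM2l s0) -real_normK ?num_real //.
  set t := `|_|; have -> : s * (s^-1 / 2 + s / 2 * t ^+ 2) = (1 + (s * t) ^+ 2) / 2.
    by field; rewrite gt_eqF.
  by have := sqr_ge0 (s * t - 1); lra.
Qed.

(* A discrete integration by parts: the expectation of [x_a / (s + |x_a|) * x_b]
   is the same after the reflections with parameters [(C, s)] and [(C, -s)]. *)
Lemma uniform_rotation_bound C s a b : a != b -> 0 < s -> 0 < C ->
  C ^+ 2 + s ^+ 2 = 1 ->
  (\int[mu]_(x in S) (C * s * ((co b x) ^+ 2 / (2 * s + `|co a x|) ^+ 2))%:E <=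
   \int[mu]_(x in S) `|co a x|%:E)%E.
Proof.
move=> ab s0 C0 CS.
have mS := @measurable_usphere R n.
have C1 : C != 1.
  apply: contraTneq s0 => C1; move: CS; rewrite C1 expr1n => h.
  suff -> : s = 0 by rewrite ltxx.
  by apply/eqP; rewrite -(sqrf_eq0 s); apply/eqP; lra.
(* The summand 1 makes the integrand nonnegative; the bound G <= 2 on the sphere makes its integral
   finite, so that it can be cancelled from both sides. *)
pose G (x : 'cV[R]_n) := 1 + co a x / (s + `|co a x|) * co b x.
have mabs D : measurable_fun D (fun x => `|co a x|).
  by apply: measurable_funTS; apply: measurableT_comp => //; exact: mcoord.
have minv m : measurable_fun [set: 'cV[R]_n] (fun x => (m * s + `|co a x|)^-1).
  by apply: measurable_invr; apply: measurable_funD.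
have mG : measurable_fun [set: 'cV[R]_n] G.
  apply: measurable_funD => //; apply: measurable_funM => //.
  by apply: measurable_funM => //; have := minv 1; under eq_fun do rewrite mul1r.
have Gb x : S x -> 0 <= G x <= 2.
  move=> Sx; have := phi_le1 (co a x) s0; have := coord_le1 b Sx => h1 h2.
  have : `|co a x / (s + `|co a x|) * co b x| <= 1.
    by rewrite normrM mulr_ile1.
  by rewrite ler_norml /G => /andP[]; lra.
have [H [HH Ha Hb]] := plane_reflection basis_e ab CS C1.
have [K [KK Ka Kb]] : exists K : 'M[R]_n,
  [/\ K^T *m K = 1%:M,
      forall x, dotv (e a) (K *m x) = C * co a x + - s * co b x &
      forall x, dotv (e b) (K *m x) = - s * co a x - C * co b x].
  by apply: plane_reflection => //; rewrite sqrrN.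
have SO Q x : Q^T *m Q = 1%:M -> S x -> S (Q *m x).
  by move=> QQ /enorm_eq1 h; apply/enorm_eq1; rewrite dotv_orthogonal.
have eGH := uniform_integral_orthogonal HH mG (fun x Sx => proj1 (andP (Gb x Sx))).
have eGK := uniform_integral_orthogonal KK mG (fun x Sx => proj1 (andP (Gb x Sx))).
have mGQ Q : measurable_fun S (fun x => G (Q *m x)).
  apply: measurable_funTS; apply: measurableT_comp mG _.
  by apply: measurable_mulmx; exact: measurable_id.
pose A x := C * s * (co b x ^+ 2 / (2 * s + `|co a x|) ^+ 2).
have mA : measurable_fun S A.
  apply: measurable_funM => //; apply: measurable_funM; first exact: measurable_funX.
  under eq_fun do rewrite -exprVn; apply: measurable_funX.
  exact: measurable_funTS.
have A0 x : 0 <= A x.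
  apply: mulr_ge0; first by rewrite mulr_ge0 // ltW.
  by apply: divr_ge0; apply: sqr_ge0.
have main : (\int[mu]_(x in S) (G (H *m x) + 2 * s * A x)%:E <=
    \int[mu]_(x in S) (G (K *m x) + 2 * s * `|co a x|)%:E)%E.
  have s2 : 0 <= 2 * s by lra.
  apply: nnr_le_integral => //.
  - by apply: measurable_funD => //; apply: measurable_funM.
  - by apply: measurable_funD => //; apply: measurable_funM.
  - move=> x Sx; apply: addr_ge0; first by case/andP: (Gb _ (SO H x HH Sx)).
    exact: mulr_ge0.
  - move=> x Sx; have := rotation_inequality (co a x) s0 C0 CS (coord_le1 b Sx).
    rewrite /G Ha Hb Ka Kb /A !mulNr => h.
    rewrite [2 * s * (C * s * _)](_ : _ =
      2 * C * s ^+ 2 * co b x ^+ 2 / (2 * s + `|co a x|) ^+ 2) //.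
    by ring.
have s2 : 0 <= 2 * s by lra.
have mA2 : measurable_fun S (fun x => 2 * s * A x) by exact: measurable_funM.
have ma2 : measurable_fun S (fun x => 2 * s * `|co a x|) by exact: measurable_funM.
have GH0 x : S x -> 0 <= G (H *m x) by move=> Sx; case/andP: (Gb _ (SO H x HH Sx)).
have GK0 x : S x -> 0 <= G (K *m x) by move=> Sx; case/andP: (Gb _ (SO K x KK Sx)).
have A20 x : S x -> 0 <= 2 * s * A x by move=> _; exact: mulr_ge0.
have a20 x : S x -> 0 <= 2 * s * `|co a x| by move=> _; exact: mulr_ge0.
move: main.
rewrite (nnr_integralD mu mS (mGQ H) mA2 GH0 A20).
rewrite (nnr_integralD mu mS (mGQ K) ma2 GK0 a20).
rewrite eGH eGK leeD2lE; last first.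
  have G2 : (\int[mu]_(x in S) (G x)%:E <= 2%:E)%E.
    apply: (@le_trans _ _ (\int[mu]_(x in S) 2%:E)%E).
      apply: nnr_le_integral => //; first exact: measurable_funTS.
      - by move=> x /Gb /andP[].
      - by move=> x /Gb /andP[].
    rewrite nnr_integral_cst // [X in (_ * X)%E](_ : _ = 1%E) ?mule1 //.
    by case: mu_unif.
  rewrite ge0_fin_numE ?(le_lt_trans G2) ?ltry //.
  by apply: integral_ge0 => x /Gb /andP[]; rewrite lee_fin.
rewrite (nnr_integralZl mu mS s2 mA (fun x _ => A0 x)).
rewrite (nnr_integralZl mu mS s2 (mabs S) (fun x _ => normr_ge0 _)).
by rewrite lee_pmul2l // lte_fin; lra.
Qed.

(** A coordinate has density of order sqrt n near 0, which explains the order sqrt (n / y). The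
    proof sums [uniform_rotation_bound] with s = sqrt y over b != a, where the squares x_b^2 add up
    to 1 - x_a^2; each term costs at most 1 / sqrt n. *)
Lemma uniform_inverse_moment y a : 0 < y -> y <= 1 / 2 ->
  (\int[mu]_(x in S) ((y + co a x ^+ 2)^-1)%:E <=
   (15 * Num.sqrt (n%:R / y))%:E)%E.
Proof.
move=> y0 y34; have mS := @measurable_usphere R n.
pose s := Num.sqrt y; have s0 : 0 < s by rewrite sqrtr_gt0.
have ss : s ^+ 2 = y by rewrite sqr_sqrtr // ltW.
pose C := Num.sqrt (1 - y); have CC : C ^+ 2 = 1 - y by rewrite sqr_sqrtr; lra.
have C0 : 0 < C by rewrite sqrtr_gt0; lra.
have C12 : 2 / 3 <= C.
  by rewrite -(ler_pXn2r (n := 2)) ?nnegrE ?(ltW C0) ?CC //; lra.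
have s1 : s <= 1.
  by rewrite -(ler_pXn2r (n := 2)) ?nnegrE ?(ltW s0) ?ss ?expr1n //; lra.
pose B b x := C * s * (co b x ^+ 2 / (2 * s + `|co a x|) ^+ 2).
have mB b : measurable_fun S (B b).
  apply: measurable_funTS; apply: measurable_funM => //.
  apply: measurable_funM; first exact: measurable_funX.
  under eq_fun do rewrite -exprVn; apply: measurable_funX.
  apply: measurable_invr; apply: measurable_funD => //.
  by apply: measurableT_comp => //; exact: mcoord.
have B0 b x : 0 <= B b x.
  apply: mulr_ge0; first by rewrite mulr_ge0 // ltW.
  by apply: divr_ge0; apply: sqr_ge0.
have minv : measurable_fun S (fun x => (y + co a x ^+ 2)^-1).
  apply: measurable_funTS; apply: measurable_invr; apply: measurable_funD => //.
  exact: measurable_funX.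
have main : (\int[mu]_(x in S) (C * s / 5 * (y + co a x ^+ 2)^-1)%:E <=
    \int[mu]_(x in S) (1 + \sum_(b | b != a) B b x)%:E)%E.
  apply: nnr_le_integral => //.
  - exact: measurable_funM.
  - apply: measurable_funD => //; under eq_fun do rewrite -big_filter.
    exact: measurable_sum.
  - move=> x _; rewrite mulr_ge0 ?invr_ge0 ?addr_ge0 ?sqr_ge0 ?(ltW y0) //.
    by rewrite divr_ge0 // mulr_ge0 // ltW.
  move=> x /enorm_eq1; case: basis_e => _ -> xx.
  have xa : \sum_(b | b != a) co b x ^+ 2 = 1 - co a x ^+ 2.
    rewrite -xx [in RHS](bigD1 a) //= expr2 addrC addrK.
    by apply: eq_bigr => b _; rewrite expr2.
  rewrite -mulr_sumr -mulr_suml xa -(real_normK (num_real (co a x))) -ss.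
  set t := `|co a x|; have t0 : 0 <= t by exact: normr_ge0.
  have d1 : 0 < s ^+ 2 + t ^+ 2 by rewrite ltr_wpDr ?sqr_ge0 // exprn_gt0.
  have d2 : 0 < (2 * s + t) ^+ 2 by rewrite exprn_gt0; lra.
  have le1 : t ^+ 2 / (2 * s + t) ^+ 2 <= 1.
    by rewrite ler_pdivrMr // mul1r ler_pXn2r ?nnegrE //; lra.
  (* Cauchy-Schwarz: (2 s + t)^2 <= (4 + 1) (s^2 + t^2). *)
  have le2 : (s ^+ 2 + t ^+ 2)^-1 <= 5 / (2 * s + t) ^+ 2.
    rewrite ler_pdivlMr // mulrC ler_pdivrMr //.
    by have := sqr_ge0 (s - 2 * t); lra.
  have Cs1 : C * s <= 1.
    have : C <= 1.
      by rewrite -(ler_pXn2r (n := 2)) ?nnegrE ?(ltW C0) ?CC ?expr1n //; lra.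
    by move=> C1; rewrite mulr_ile1 // ltW.
  have Cs0 : 0 < C * s by rewrite mulr_gt0.
  have := ler_wpM2l (ltW Cs0) le1; have := ler_wpM2l (ltW Cs0) le2.
  rewrite mulrBl div1r.
  lra.
have uS : mu S = 1%E by case: mu_unif.
have Cs5 : 0 <= C * s / 5 by rewrite divr_ge0 // mulr_ge0 // ltW.
have i0 x : S x -> 0 <= (y + co a x ^+ 2)^-1.
  by move=> _; rewrite invr_ge0 addr_ge0 ?sqr_ge0 ?(ltW y0).
have mBs : measurable_fun S (fun x => \sum_(b | b != a) B b x).
  by under eq_fun do rewrite -big_filter; exact: measurable_sum.
have Bs0 x : S x -> 0 <= \sum_(b | b != a) B b x by move=> _; rewrite sumr_ge0.
move: main; rewrite (nnr_integralZl mu mS Cs5 minv i0).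
rewrite (nnr_integralD (f := fun=> 1) mu mS _ mBs _ Bs0) //.
have -> : (\int[mu]_(x in S) 1%:E = 1)%E by rewrite nnr_integral_cst // mul1e.
rewrite (nnr_integral_sum mu mS _ mB (fun b x _ => B0 b x)) => main.
have sn0 : 0 < Num.sqrt n%:R :> R by rewrite sqrtr_gt0 ltr0n.
have snn : Num.sqrt n%:R ^+ 2 = n%:R :> R by rewrite sqr_sqrtr // ler0n.
have sn1 : 1 <= Num.sqrt n%:R :> R.
  by rewrite -(ler_pXn2r (n := 2)) ?nnegrE ?snn ?expr1n ?ler1n // ltW.
have main2 : ((C * s / 5)%:E * \int[mu]_(x in S) ((y + co a x ^+ 2)^-1)%:E <=
    (1 + Num.sqrt n%:R)%:E)%E.
  apply: le_trans main _; rewrite EFinD leeD2l //.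
  apply: (@le_trans _ _ (\sum_(b < n | b != a) (Num.sqrt n%:R)^-1%:E)%E).
    apply: lee_sum => b ba; apply: le_trans (uniform_abs_coord a).
    by apply: uniform_rotation_bound; rewrite // 1?eq_sym // CC ss; ring.
  rewrite sumEFin lee_fin; apply: le_trans (_ : \sum_(b < n) (Num.sqrt n%:R)^-1 <= _).
    rewrite big_mkcond /=; apply: ler_sum => b _.
    by case: ifP => // _; rewrite invr_ge0 ltW.
  rewrite sumr_const card_ord; move: sn0 snn; set q := Num.sqrt _ => q0 qq.
  by rewrite -mulr_natr -qq expr2 mulrA mulVf ?mul1r // gt_eqF.
have Cs0 : 0 < C * s / 5 by rewrite divr_gt0 // mulr_gt0.
(* The constant 15 is 2 times 5 divided by 2 / 3, from 1 + sqrt n <= 2 sqrt n, the 5 above and C >=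
   2 / 3. *)
rewrite -(@lee_pmul2l _ (C * s / 5)%:E) //.
apply: le_trans main2 _; rewrite -EFinM lee_fin.
rewrite sqrtrM ?ler0n // sqrtrV ?(ltW y0) // -/s.
have -> : C * s / 5 * (15 * (Num.sqrt n%:R / s)) = 3 * C * Num.sqrt n%:R.
  by field; rewrite gt_eqF.
have : 2 / 3 * Num.sqrt n%:R <= C * Num.sqrt n%:R by rewrite ler_wpM2r // ltW.
lra.
Qed.

End uniform_distribution.

(** * Markov property of a chain driven by independent samples *)

Section markov_chain.
Context (R : realType) (dT dE dF : measure_display).
Context (T : measurableType dT) (E : measurableType dE) (F : measurableType dF).
Context (P : probability T R) (X : nat -> {RV P >-> F}) (U : {RV P >-> F}).
Context (init : F -> E) (step : E * F -> E).
Hypothesis minit : measurable_fun [set: F] init.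
Hypothesis mstep : measurable_fun [set: E * F] step.
Hypothesis indepX : mutually_independent X.
Hypothesis indepU : independent_of_seq U X.

Fixpoint chain (n : nat) (w : T) : E :=
  if n is m.+1 then step (chain m w, X m w) else init (U w).

Lemma measurable_chain n : measurable_fun [set: T] (chain n).
Proof.
elim: n => [|n IH] /=; first exact: measurableT_comp.
apply: measurableT_comp mstep _.
by apply/measurable_fun_pairP; split; [exact: IH | exact: (measurable_funPT (X n))].
Qed.

Let S n : {RV P >-> E} :=
  HB.pack (chain n) (isMeasurableFun.Build _ _ _ _ _ (measurable_chain n)).

Let mSX n : measurable_fun [set: T] (fun w => (chain n w, X n w)).
Proof.
apply/measurable_fun_pairP.
by split; [exact: (measurable_chain n) | exact: (measurable_funPT (X n))].
Qed.

Let SX n : {mfun T >-> (E * F)%type} :=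
  HB.pack (fun w => (chain n w, X n w)) (isMeasurableFun.Build _ _ _ _ _ (mSX n)).

Let cyl (s : seq nat) (B : nat -> set F) : set T :=
  \bigcap_(n in [set` s]) (X n @^-1` B n).

Let mcyl s B : (forall n, measurable (B n)) -> measurable (cyl s B).
Proof.
move=> mB; apply: fin_bigcap_measurable; first exact: finite_seq.
by move=> n _; rewrite -[X in measurable X]setTI; exact: measurable_funPT.
Qed.

(** The induction invariant: the state at time n is independent of every finite cylinder of samples
    with index at least n. Index n is included because [X n] drives the step from n to n + 1. *)
Definition future_independent n := forall (s : seq nat) A B, uniq s -> all (leq n) s ->
  measurable A -> (forall n, measurable (B n)) ->
  P (chain n @^-1` A `&` cyl s B) =
  (P (chain n @^-1` A) * \prod_(i <- s) P (X i @^-1` B i))%E.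

Lemma future_independent0 : future_independent 0.
Proof.
move=> s A B us _ mA mB; rewrite -(indepX us mB).
have -> : chain 0 @^-1` A = U @^-1` (init @^-1` A) by [].
apply: indepU; first by rewrite -[X in measurable X]setTI; exact: minit.
set G := [set H | _].
apply: (@fin_bigcap_measurable _ (g_sigma_algebraType G)); first exact: finite_seq.
by move=> n _; apply: sub_sigma_algebra; exists n, (B n).
Qed.

(* Dividing by the probability of the cylinder makes the restricted law a
   measure that agrees with the product law on rectangles. *)
Lemma joint_law n (s : seq nat) B : future_independent n -> uniq s ->
  all (leq n.+1) s -> (forall n, measurable (B n)) ->
  forall C, measurable C ->
  P (SX n @^-1` C `&` cyl s B) =
  ((distribution P (S n) \x distribution P (X n)) C *
   \prod_(i <- s) P (X i @^-1` B i))%E.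
Proof.
move=> In us las mB C mC.
have PK : P (cyl s B) = (\prod_(i <- s) P (X i @^-1` B i))%E by apply: indepX.
rewrite -PK.
have mK : measurable (cyl s B) by exact: mcyl.
have mSC : measurable (SX n @^-1` C).
  by rewrite -[X in measurable X]setTI; exact: measurable_funPT.
(* A null cylinder cannot be divided by, but then both sides are 0. *)
have [K0|K0] := eqVneq (P (cyl s B)) 0%E.
  rewrite K0 mule0; apply/eqP; rewrite eq_le measure_ge0 andbT -K0.
  by apply: le_measure; rewrite ?inE //; exact: measurableI.
have Kfin : P (cyl s B) \is a fin_num by exact: fin_num_measure.
set c := fine (P (cyl s B)).
have c0 : 0 < c.
  by rewrite fine_gt0 // lt0e K0 measure_ge0 -ge0_fin_numE ?Kfin //.
have cE : P (cyl s B) = c%:E by rewrite fineK.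
have ci0 : 0 <= c^-1 by rewrite invr_ge0 ltW.
pose r : {measure set T -> \bar R} := mrestr P mK.
pose m0 := mscale (NngNum ci0) (pushforward r (SX n)).
pose m : {measure set (E * F) -> \bar R} := m0 (mSX n).
have -> : (distribution P (S n) \x distribution P (X n))%E C = m C.
  apply: (@product_measure_unique _ _ _ _ R (distribution P (S n))
    (distribution P (X n)) m) => // A B' mA mB'.
  rewrite /m /m0 /mscale /= /pushforward /r /mrestr.
  pose B1 k := if k == n then B' else B k.
  have mB1 k : measurable (B1 k) by rewrite /B1; case: eqP.
  have ns : n \notin s by apply/negP => /(allP las); rewrite ltnn.
  have eB1 i : i \in s -> B1 i = B i.
    by rewrite /B1; case: eqP => // ->; rewrite (negbTE ns).
  have := In (n :: s) A B1 _ _ mA mB1.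
  rewrite /= ns us leqnn => /(_ isT).
  have -> : all (leq n) s by apply: sub_all las => k /ltnW.
  move=> /(_ isT).
  rewrite big_cons {2}/B1 eqxx.
  rewrite (eq_big_seq (fun i => P (X i @^-1` B i))) => [|i /eB1 -> //].
  rewrite -PK.
  have -> : chain n @^-1` A `&` cyl (n :: s) B1 =
      (fun w => (chain n w, X n w)) @^-1` (A `*` B') `&` cyl s B.
    apply/seteqP; split=> w /=.
      move=> [Aw Cw]; split; first split => //=.
        by have := Cw n; rewrite /= mem_head /B1 eqxx; apply.
      move=> i /= si; have := Cw i; rewrite /= in_cons si orbT eB1 //; exact.
    move=> [[/= Aw Bw] Cw]; split=> // i /=; rewrite in_cons /B1.
    by case: eqP => [-> _ //|_ /= si]; exact: Cw.
  move=> h; rewrite [X in (_ * X = _)%E]h.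
  by rewrite cE muleCA; congr (_ * _)%E; rewrite muleCA -EFinM mulVf ?gt_eqF // mule1.
rewrite /m /m0 /mscale /= /pushforward /r /mrestr cE muleC muleA -EFinM.
by rewrite mulfV ?gt_eqF // mul1e.
Qed.

Lemma chain_future_independent n : future_independent n.
Proof.
elim: n => [|n IH]; first exact: future_independent0.
move=> s A B us las mA mB.
have mSA : measurable (step @^-1` A).
  by rewrite -[X in measurable X]setTI; exact: mstep.
have e : chain n.+1 @^-1` A = SX n @^-1` (step @^-1` A) by [].
rewrite e (joint_law IH us las mB mSA); congr (_ * _)%E.
have := joint_law IH (isT : uniq [::]) isT mB mSA.
by rewrite big_nil mule1 /cyl set_nil bigcap_set0 setIT.
Qed.

Lemma markov_integral n (f : E -> \bar R) : measurable_fun [set: E] f ->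
  (forall x, 0 <= f x)%E ->
  (\int[P]_w f (chain n.+1 w) =
   \int[P]_w \int[P]_w' f (step (chain n w, X n w')))%E.
Proof.
move=> mf f0.
have mfs : measurable_fun [set: E * F] (f \o step) by exact: measurableT_comp.
transitivity (\int[distribution P (SX n)]_z (f \o step) z)%E.
  by rewrite ge0_integral_distribution // => z; exact: f0.
transitivity (\int[distribution P (S n) \x distribution P (X n)]_z (f \o step) z)%E.
  apply: eq_measure_integral => C mC _.
  have := joint_law (@chain_future_independent n) (isT : uniq [::]) isT
    (fun _ => measurableT) mC.
  by rewrite big_nil mule1 /cyl set_nil bigcap_set0 setIT.
rewrite fubini_tonelli1 //; last by move=> z; exact: f0.
rewrite (ge0_integral_distribution (S n)) //; first last.
- by move=> y; apply: integral_ge0 => z _; exact: f0.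
- by apply: measurable_fun_fubini_tonelli_F => // z; exact: f0.
apply: eq_integral => w _ /=; rewrite /fubini_F /=.
rewrite ge0_integral_distribution //.
apply: (measurableT_comp mfs (g := fun y => (chain n w, y))).
exact: pair1_measurable.
Qed.

Lemma markov_integral_le n (f g : E -> \bar R) : measurable_fun [set: E] f ->
  (forall x, 0 <= f x)%E -> measurable_fun [set: E] g ->
  (forall x, \int[P]_w f (step (x, X n w)) <= g x)%E ->
  (\int[P]_w f (chain n.+1 w) <= \int[P]_w g (chain n w))%E.
Proof.
move=> mf f0 mg fg; rewrite markov_integral //; apply: ge0_le_integral => //.
- by move=> w _; apply: integral_ge0.
- pose h (z : T * T) := f (step (chain n z.1, X n z.2)).
  apply: (@measurable_fun_fubini_tonelli_F _ _ _ _ _ P h); last first.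
    by move=> z; exact: f0.
  apply: measurableT_comp mf _; apply: measurableT_comp mstep _.
  apply/measurable_fun_pairP; split.
    exact: measurableT_comp (measurable_chain n) measurable_fst.
  exact: measurableT_comp (measurable_funPT (X n)) measurable_snd.
- exact: measurableT_comp mg (measurable_chain n).
Qed.

End markov_chain.

Section subgaussian_moments.
Context (R : realType) (n : nat) (d : measure_display) (T : measurableType d).
Context (P : probability T R) (Z : {RV P >-> 'cV[R]_n}).
Hypothesis subgZ : standardized_subgaussian Z.
Implicit Types a b v : 'cV[R]_n.
Local Notation D := [set: T].

Let mZ a (E : set T) : measurable_fun E (fun w => dotv a (Z w)).
Proof. by apply: measurable_funTS; apply: measurable_dotv. Qed.

Let mZi i (E : set T) : measurable_fun E (fun w => Z w i 0).
Proof. by apply: measurable_funTS; exact: measurable_coordT. Qed.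

Lemma fourth_moment_unit v : dotv v v = 1 ->
  (\int[P]_w (dotv v (Z w) ^+ 4)%:E <= 16%:E)%E.
Proof.
move=> vv; case: subgZ => _ _ psi.
set Y := fun w => dotv v (Z w).
have : (psi2_norm P Y <= 1)%E.
  apply: le_trans psi; apply: ereal_sup_ubound; exists v => //.
  exact/enorm_eq1.
rewrite /psi2_norm => h.
have : ((4 `^ (- 2^-1))%:E * 'N[P]_(4%:E)[EFin \o Y] <= 1)%E.
  by apply: le_trans h; apply: ereal_sup_ubound; exists 4 => //=; rewrite ler1n.
have -> : 4 `^ (- 2^-1) = 2^-1 :> R.
  rewrite powRN powR12_sqrt //; congr (_^-1).
  by rewrite (_ : 4 = 2 ^+ 2) ?sqrtr_sqr ?ger0_norm // -natrX.
rewrite unlock => {}h.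
have -> : (\int[P]_w (Y w ^+ 4)%:E = \int[P]_w (`|(EFin \o Y) w| `^ 4))%E.
  apply: eq_integral => w _ /=; rewrite ?poweR_EFin; congr EFin.
  by rewrite powR_mulrn ?normr_ge0 // -normrX ger0_norm // exprn_even_ge0.
move: h; set I := integral _ _ _ => h.
have I0 : (0 <= I)%E by apply: integral_ge0 => w _; exact: poweR_ge0.
have J2 : (I `^ 4^-1 <= 2%:E)%E.
  rewrite -(@lee_pmul2l _ (2^-1)%:E) ?lte_fin ?invr_gt0 //.
  by apply: le_trans h _; rewrite -EFinM mulVf.
have -> : I = ((I `^ 4^-1) `^ 4)%E by rewrite -poweRrM mulVf // poweRe1.
have -> : 16%:E = (2%:E `^ 4)%E :> \bar R.
  by rewrite poweR_EFin powR_mulrn // -natrX.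
by apply: gt0_ler_poweR; rewrite ?in_itv /= ?poweR_ge0 ?leey ?lee_fin ?ler0n.
Qed.

Lemma fourth_moment v :
  (\int[P]_w (dotv v (Z w) ^+ 4)%:E <= (16 * dotv v v ^+ 2)%:E)%E.
Proof.
have [->|v0] := eqVneq v 0.
  under eq_integral do rewrite dotv0l expr0n /=.
  by rewrite integral0 lee_fin mulr_ge0 // sqr_ge0.
have vv : 0 < dotv v v by rewrite lt_def dotv_ge0 dotv_eq0 v0.
pose s := enorm v; have ss : s ^+ 2 = dotv v v by exact: sqr_enorm.
have s0 : 0 < s by rewrite sqrtr_gt0.
pose u := s^-1 *: v.
have uu : dotv u u = 1.
  by rewrite /u dotvZl dotvZr -ss expr2; field; rewrite gt_eqF.
have -> : (\int[P]_w (dotv v (Z w) ^+ 4)%:E =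
    \int[P]_w (s ^+ 4 * dotv u (Z w) ^+ 4)%:E)%E.
  apply: eq_integral => w _; congr EFin.
  by rewrite /u dotvZl -exprMn mulrA mulfV ?gt_eqF // mul1r.
rewrite nnr_integralZl //; last 3 first.
- by rewrite exprn_ge0 // ltW.
- exact: measurable_funX.
- by move=> w _; rewrite exprn_even_ge0.
apply: le_trans (lee_wpmul2l _ (fourth_moment_unit uu)) _.
  by rewrite lee_fin exprn_ge0 // ltW.
by rewrite -EFinM lee_fin -ss -exprM mulrC.
Qed.

Let integrable_coord2 i j : P.-integrable D (fun w => (Z w i 0 * Z w j 0)%:E).
Proof.
have sq k : P.-integrable D (fun w => (Z w k 0 ^+ 2)%:E).
  apply/integrableP; split.
    by apply/measurable_EFinP; exact: measurable_funX.
  case: subgZ => _ /(_ k k) + _; rewrite unlock eqxx => h.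
  under eq_integral => w _ do rewrite abse_EFin ger0_norm ?sqr_ge0 // expr2.
  by rewrite h ltry.
apply: (le_integrable _ _ _ (integrableD _ (sq i) (sq j))) => //.
  by apply/measurable_EFinP; apply: measurable_funM.
move=> w _ /=; rewrite lee_fin [leRHS]ger0_norm ?addr_ge0 ?sqr_ge0 //.
rewrite normrM -(real_normK (num_real (Z w i 0))) -(real_normK (num_real (Z w j 0))).
have := normr_ge0 (Z w i 0); have := normr_ge0 (Z w j 0).
set p := `|_|; set q := `|_| => p0 q0.
by have := sqr_ge0 (q - p); have := sqr_ge0 (q + p); lra.
Qed.

Let dotv_prodE a b w : (dotv a (Z w) * dotv b (Z w))%:E =
  (\sum_i \sum_j (a i 0 * b j 0)%:E * (Z w i 0 * Z w j 0)%:E)%E.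
Proof.
rewrite !dotvE mulr_suml -sumEFin; apply: eq_bigr => i _.
rewrite mulr_sumr -sumEFin; apply: eq_bigr => j _.
by rewrite -EFinM mulrACA.
Qed.

Lemma integrable_dotv_prod a b :
  P.-integrable D (fun w => (dotv a (Z w) * dotv b (Z w))%:E).
Proof.
under eq_fun do rewrite dotv_prodE.
apply: integrable_sum => // i _; apply: integrable_sum => // j _.
exact: integrableZl.
Qed.

Lemma expectation_dotv_prod a b :
  (\int[P]_w (dotv a (Z w) * dotv b (Z w))%:E = (dotv a b)%:E)%E.
Proof.
under eq_integral do rewrite dotv_prodE.
rewrite integral_sum // => [|i]; last first.
  by apply: integrable_sum => // j _; exact: integrableZl.
rewrite dotvE -sumEFin; apply: eq_bigr => i _.
rewrite integral_sum // => [|j]; last exact: integrableZl.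
rewrite (bigD1 i) //= big1 => [|j ji].
  rewrite integralZl //; case: subgZ => _ /(_ i i) + _.
  by rewrite unlock eqxx => ->; rewrite -EFinM mulr1 adde0.
rewrite integralZl //; case: subgZ => _ /(_ i j) + _.
by rewrite unlock eq_sym (negbTE ji) => ->; rewrite mule0.
Qed.

Lemma quadratic_moment c a b :
  (\int[P]_w ((c + dotv a (Z w) * dotv b (Z w)) ^+ 2)%:E <=
   (c ^+ 2 + 2 * c * dotv a b + 16 * dotv a a * dotv b b)%:E)%E.
Proof.
have PT : P D = 1%E by exact: probability_setT.
have [a0|a0] := eqVneq a 0.
  rewrite a0; under eq_integral do rewrite dotv0l mul0r addr0.
  rewrite !dotv0l !(mulr0, mul0r, addr0).
  by rewrite nnr_integral_cst // [X in (_ * X)%E]PT mule1 // lee_fin.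
have [b0|b0] := eqVneq b 0.
  rewrite b0; under eq_integral do rewrite dotv0l mulr0 addr0.
  rewrite !dotv0r !(mulr0, addr0).
  by rewrite nnr_integral_cst // [X in (_ * X)%E]PT mule1 // lee_fin.
have aa : 0 < dotv a a by rewrite lt_def dotv_ge0 dotv_eq0 a0.
have bb : 0 < dotv b b by rewrite lt_def dotv_ge0 dotv_eq0 b0.
pose t := dotv b b / dotv a a; have t0 : 0 < t by rewrite divr_gt0.
pose W w := t / 2 * dotv a (Z w) ^+ 4 + t^-1 / 2 * dotv b (Z w) ^+ 4.
have mW : measurable_fun D W.
  by apply: measurable_funD; apply: measurable_funM => //; exact: measurable_funX.
have t20 : 0 <= t / 2 by rewrite divr_ge0 // ltW.
have t'20 : 0 <= t^-1 / 2 by rewrite divr_ge0 // invr_ge0 ltW.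
have W0 w : 0 <= W w.
  by apply: addr_ge0; apply: mulr_ge0 => //; exact: exprn_even_ge0.
have IW : (\int[P]_w (W w)%:E <= (16 * dotv a a * dotv b b)%:E)%E.
  have m4 v : measurable_fun D (fun w => dotv v (Z w) ^+ 4).
    exact: measurable_funX.
  have p4 v w : D w -> 0 <= dotv v (Z w) ^+ 4 by move=> _; rewrite exprn_even_ge0.
  have mm k v : measurable_fun D (fun w => k * dotv v (Z w) ^+ 4).
    exact: measurable_funM.
  have pp k v w : 0 <= k -> D w -> 0 <= k * dotv v (Z w) ^+ 4.
    by move=> k0 Dw; rewrite mulr_ge0 // p4.
  rewrite (nnr_integralD P measurableT (mm _ _) (mm _ _)
    (fun w => @pp _ _ w t20) (fun w => @pp _ _ w t'20)).
  rewrite (nnr_integralZl P measurableT t20 (m4 a) (p4 a)).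
  rewrite (nnr_integralZl P measurableT t'20 (m4 b) (p4 b)).
  have ha : ((t / 2)%:E * \int[P]_w (dotv a (Z w) ^+ 4)%:E <=
      (t / 2)%:E * (16 * dotv a a ^+ 2)%:E)%E.
    by apply: lee_wpmul2l (fourth_moment a).
  have hb : ((t^-1 / 2)%:E * \int[P]_w (dotv b (Z w) ^+ 4)%:E <=
      (t^-1 / 2)%:E * (16 * dotv b b ^+ 2)%:E)%E.
    by apply: lee_wpmul2l (fourth_moment b).
  apply: le_trans (leeD ha hb) _.
  rewrite -!EFinM -EFinD lee_fin /t.
  by rewrite le_eqVlt; apply/orP; left; apply/eqP; field; rewrite !gt_eqF.
have intW : P.-integrable D (EFin \o W).
  apply/integrableP; split; first exact/measurable_EFinP.
  under eq_integral => w _ do rewrite /= ger0_norm //.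
  by rewrite (le_lt_trans IW) // ltry.
have intc : P.-integrable D (fun w => (c ^+ 2)%:E).
  exact: finite_measure_integrable_cst.
have intab := integrable_dotv_prod a b.
have intab2 := integrableZl measurableT (2 * c) intab.
have int1 := integrableD measurableT intc intab2.
apply: (@le_trans _ _ (\int[P]_w ((c ^+ 2)%:E +
    (2 * c)%:E * (dotv a (Z w) * dotv b (Z w))%:E + (EFin \o W) w)%E)%E).
  apply: ge0_le_integral => //.
  - by move=> w _; rewrite lee_fin sqr_ge0.
  - apply/measurable_EFinP; apply: measurable_funX; apply: measurable_funD => //.
    exact: measurable_funM.
  - by apply: measurable_int (integrableD measurableT int1 intW).
  move=> w _ /=; rewrite -EFinM -!EFinD lee_fin /W.
  set p := dotv a (Z w); set q := dotv b (Z w).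
  have : 0 <= t / 2 * (p ^+ 2 - t^-1 * q ^+ 2) ^+ 2.
    by rewrite mulr_ge0 ?sqr_ge0 // divr_ge0 // ltW.
  have -> : t / 2 * (p ^+ 2 - t^-1 * q ^+ 2) ^+ 2 =
     t / 2 * p ^+ 4 + t^-1 / 2 * q ^+ 4 - p ^+ 2 * q ^+ 2.
    by field; rewrite gt_eqF.
  by rewrite sqrrD exprMn; lra.
rewrite (integralD measurableT int1 intW) (integralD measurableT intc intab2).
rewrite integralZl // expectation_dotv_prod.
have -> : (\int[P]_w (c ^+ 2)%:E = (c ^+ 2)%:E)%E.
  by rewrite nnr_integral_cst // [X in (_ * X)%E]PT mule1 // lee_fin.
by rewrite -EFinM -EFinD [leRHS]EFinD; exact: leeD2l.
Qed.

End subgaussian_moments.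

Section sample_moments.
Context (R : realType) (n : nat) (dZ dX : measure_display).
Context (TZ : measurableType dZ) (T : measurableType dX).
Context (PZ : probability TZ R) (P : probability T R).
Context (Z : {RV PZ >-> 'cV[R]_n}) (X : nat -> {RV P >-> 'cV[R]_n}).
Context (M : 'M[R]_n).
Hypothesis subgZ : standardized_subgaussian Z.
Hypothesis MT : M^T = M.
Hypothesis iidX : iid_copies M Z X.

Lemma sample_quadratic_moment k c a b :
  (\int[P]_w ((c + dotv a (X k w) * dotv b (X k w)) ^+ 2)%:E <=
   (c ^+ 2 + 2 * c * dotv a (M *m M *m b) +
    16 * dotv a (M *m M *m a) * dotv b (M *m M *m b))%:E)%E.
Proof.
have dM u v : dotv u (M *m M *m v) = dotv (M *m u) (M *m v).
  by rewrite -mulmxA dotv_mulmxr MT.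
rewrite !dM.
apply: le_trans (quadratic_moment subgZ c (M *m a) (M *m b)).
pose f (x : 'cV[R]_n) := ((c + dotv a x * dotv b x) ^+ 2)%:E.
have md v : measurable_fun [set: 'cV[R]_n] (fun x => dotv v x).
  by apply: measurable_dotv => //; exact: measurable_id.
have mf : measurable_fun [set: 'cV[R]_n] f.
  apply/measurable_EFinP; apply: measurable_funX; apply: measurable_funD => //.
  exact: measurable_funM.
have f0 x : (0 <= f x)%E by rewrite lee_fin sqr_ge0.
have mMZ : measurable_fun [set: TZ] (fun w => M *m Z w).
  exact: measurable_mulmx.
rewrite le_eqVlt; apply/orP; left; apply/eqP.
transitivity (\int[distribution P (X k)]_x f x)%E.
  by rewrite ge0_integral_distribution.
transitivity (\int[pushforward PZ (fun w => M *m Z w)]_x f x)%E.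
  by apply: eq_measure_integral => A mA _; case: iidX => _ h; exact: h.
rewrite ge0_integral_pushforward // preimage_setT.
by apply: eq_integral => w _ /=; rewrite /f !dotv_mulmxr MT.
Qed.

End sample_moments.

Section spectrum_bounds.
Context (R : realType).

Lemma pca_spectrum_bounds d (lam : d.-tuple R) k :
  pca_spectrum lam -> (2 <= k <= d)%N -> 0 <= ev lam k <= ev lam 2.
Proof.
case=> d2 _ dec ed /andP[k2 kd].
have mono m j : (2 <= j)%N -> (j + m <= d)%N -> ev lam (j + m) <= ev lam j.
  move=> j2; elim: m => [|m IH] jm; first by rewrite addn0.
  apply: le_trans (IH _); last by apply: leq_trans jm; rewrite leq_add2l.
  by rewrite addnS; apply: dec; rewrite -addnS jm (leq_trans j2) // leq_addr.
apply/andP; split.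
  by apply: le_trans ed _; have := mono (d - k)%N k k2; rewrite subnKC //; exact.
by have := mono (k - 2)%N 2 (leqnn 2); rewrite subnKC //; exact.
Qed.

Lemma spectral_sumE n (lam : n.+1.-tuple R) :
  spectral_sum lam =
  \sum_(k < n.+1 | k != 0) lam`_k / (lam`_0 - lam`_k).
Proof.
rewrite /spectral_sum !big_add1 /= big_mkord [RHS]big_mkcond big_ord_recl /=.
by rewrite add0r.
Qed.

Lemma spectral_sum_le d (lam : d.-tuple R) : pca_spectrum lam ->
  spectral_sum lam <= d.-1%:R * (ev lam 2 / gap lam).
Proof.
move=> hlam; have [d2 g0 _ _] := hlam.
have -> : d.-1%:R * (ev lam 2 / gap lam) = \sum_(2 <= k < d.+1) ev lam 2 / gap lam.
  by rewrite sumr_const_nat subSS subn1 mulr_natl.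
rewrite /spectral_sum !big_nat; apply: ler_sum => k kd.
have /andP[k0 k2] := pca_spectrum_bounds hlam kd.
rewrite /gap; apply: ler_pM => //; first by rewrite invr_ge0; lra.
by rewrite lef_pV2 ?posrE; lra.
Qed.

End spectrum_bounds.

Section moment_recursion.
Context (R : realFieldType).

(* [Q] is the second moment off the leading eigenvector, [D] that of the
   leading coordinate minus one and [q] that of the leading coordinate. *)
Lemma coupled_recursion (Q D q : nat -> R) (kappa a b tau : R) (N : nat) :
  0 < kappa < 1 -> 0 <= a -> 0 <= b -> 0 <= tau -> kappa + 4 * b <= 1 ->
  a * (5 * N%:R + tau / (1 - kappa)) <= 1 ->
  Q 0 <= tau -> D 0 = 0 ->
  (forall t, Q t.+1 <= kappa * Q t + b * q t) ->
  (forall t, D t.+1 <= D t + a * (q t + Q t)) ->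
  (forall t, q t <= 2 + 2 * D t) ->
  forall t, (t <= N)%N ->
  D t <= a * (5 * N%:R + tau / (1 - kappa)) /\ q t + Q t <= 5 + kappa ^+ t * tau.
Proof.
move=> /andP[k0 k1] a0 b0 tau0 kb aN Q0 D0 Qr Dr qr.
have k1' : 0 < 1 - kappa by lra.
have main t : (t <= N)%N -> Q t <= kappa ^+ t * tau + 1 /\
    D t <= a * (5 * t%:R + tau * (1 - kappa ^+ t) / (1 - kappa)).
  have Dbound s : (s <= N)%N ->
      a * (5 * s%:R + tau * (1 - kappa ^+ s) / (1 - kappa)) <=
      a * (5 * N%:R + tau / (1 - kappa)).
    move=> sN; rewrite ler_wpM2l // lerD ?ler_wpM2l ?ler_nat //.
    rewrite ler_wpM2r ?invr_ge0 ?(ltW k1') // -[leRHS]mulr1 ler_wpM2l //.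
    by rewrite gerBl exprn_ge0 // ltW.
  elim: t => [|t IH] tN.
    by rewrite expr0 D0 subrr !(mulr0n, mulr0, mul0r, addr0); split=> //; lra.
  have [IQ ID] := IH (ltnW tN).
  have D1 : D t <= 1 by apply: le_trans ID (le_trans (Dbound t (ltnW tN)) aN).
  have q4 : q t <= 4 by have := qr t; lra.
  split.
    apply: le_trans (Qr t) _; rewrite exprS.
    have h1 := ler_wpM2l (ltW k0) IQ; have h2 := ler_wpM2l b0 q4.
    by rewrite -mulrA; lra.
  apply: le_trans (Dr t) _.
  have h : q t + Q t <= 5 + kappa ^+ t * tau by lra.
  have := ler_wpM2l a0 h; move: ID => /lerD /[apply] h'.
  apply: le_trans h' _; rewrite -mulrDr ler_wpM2l // le_eqVlt; apply/orP; left.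
  by apply/eqP; rewrite exprS -natr1; field; rewrite gt_eqF.
move=> t tN; have [IQ ID] := main t tN.
have D1 : D t <= a * (5 * N%:R + tau / (1 - kappa)).
  apply: le_trans ID _; rewrite ler_wpM2l // lerD ?ler_wpM2l ?ler_nat //.
  rewrite ler_wpM2r ?invr_ge0 ?(ltW k1') // -[leRHS]mulr1 ler_wpM2l //.
  by rewrite gerBl exprn_ge0 // ltW.
by split=> //; have := qr t; lra.
Qed.

Lemma forced_recursion (q : nat -> R) (rho kappa b tau : R) (N : nat) :
  0 <= rho -> rho < 1 -> rho <= kappa -> 0 < kappa -> 0 <= b -> 0 <= tau ->
  0 <= q 0 ->
  (forall t, (t < N)%N -> q t.+1 <= rho * q t + b * (5 + kappa ^+ t * tau)) ->
  q N <= kappa ^+ N * q 0 + b * (5 / (1 - rho) + tau * (N%:R * kappa ^+ N / kappa)).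
Proof.
move=> r0 r1 rk k0 b0 tau0 q0 qr.
have r1' : 0 < 1 - rho by lra.
suff main t : (t <= N)%N -> q t <= kappa ^+ t * q 0 +
    b * (5 / (1 - rho) + tau * (t%:R * kappa ^+ t / kappa)) by exact: main.
elim: t => [|t IH] tN.
  by rewrite expr0 mul1r lerDl !mul0r mulr0 addr0 mulr_ge0 // divr_ge0 // ltW.
apply: le_trans (qr t tN) _.
have kt : 0 <= kappa ^+ t by rewrite exprn_ge0 // ltW.
have h := ler_wpM2l r0 (IH (ltnW tN)).
apply: le_trans (lerD h (lexx _)) _.
have h1 : rho * (kappa ^+ t * q 0) <= kappa * (kappa ^+ t * q 0).
  by rewrite ler_wpM2r // mulr_ge0.
have h2 : rho * (b * (tau * (t%:R * kappa ^+ t / kappa))) <=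
    kappa * (b * (tau * (t%:R * kappa ^+ t / kappa))).
  by rewrite ler_wpM2r // !mulr_ge0 ?invr_ge0 ?ler0n // ltW.
have -> : kappa ^+ t.+1 * q 0 + b * (5 / (1 - rho) +
    tau * (t.+1%:R * kappa ^+ t.+1 / kappa)) =
  kappa * (kappa ^+ t * q 0) + (rho * (b * (5 / (1 - rho))) +
    kappa * (b * (tau * (t%:R * kappa ^+ t / kappa)))) + b * (5 + kappa ^+ t * tau).
  by rewrite exprS -natr1; field; rewrite !gt_eqF.
lra.
Qed.

End moment_recursion.

Section logarithm.
Context (R : realType).

Lemma ln_ge_1BV (x : R) : 0 < x -> 1 - x^-1 <= ln x.
Proof.
move=> x0; rewrite -[x in ln x]invrK lnV ?posrE ?invr_gt0 //.
have := @le_ln1Dx R (x^-1 - 1); rewrite [1 + _]addrC subrK => h.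
have := h _; rewrite ltrBrDl subrr invr_gt0 => /(_ x0); lra.
Qed.

Lemma ln_le_sqrt (x : R) : 0 < x -> ln x <= 2 * Num.sqrt x.
Proof.
move=> x0; have s0 : 0 < Num.sqrt x by rewrite sqrtr_gt0.
rewrite -{1}(sqr_sqrtr (ltW x0)) lnXn // mulr2n.
by have := ln_sublinear s0; lra.
Qed.

End logarithm.

Section step_conditions.
Context (R : realType) (d : nat) (lam : d.-tuple R) (N : nat) (eps0 delta b3 : R).
Local Notation L1 := (ev lam 1).
Local Notation L2 := (ev lam 2).
Local Notation g := (gap lam).
Local Notation beta := (stepsize lam N).
Local Notation r := (rescaled_stepsize lam N).
Local Notation L := (@ln R N%:R).
Hypothesis hlam : pca_spectrum lam.
Hypothesis heps : 0 < eps0 < 8^-1.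
Hypothesis hdelta : 0 < delta < 1 / 2.
Hypothesis b3_le : b3 <= (1000 * 100)^-1.
Hypothesis beta_gt0 : 0 < beta.
Hypothesis hA : condA b3 eps0 lam N delta.
Hypothesis hB : condB 1 eps0 lam N delta.

Lemma gap_gt0 : 0 < g.
Proof. by case: hlam => _ + _ _; rewrite /gap; lra. Qed.

Lemma ev2_ge0 : 0 <= L2.
Proof.
have [d2 _ _ _] := hlam.
by have /andP[] := @pca_spectrum_bounds R d lam 2 hlam d2.
Qed.

Lemma N_gt1 : (1 < N)%N.
Proof.
case: N beta_gt0 => [|[|//]]; rewrite /stepsize ?mulr0 ?invr0 ?mulr0 ?ltxx //.
by rewrite ln1 mulr0 mul0r ltxx.
Qed.

Let N0 : 0 < N%:R :> R. Proof. by rewrite ltr0n ltnW // N_gt1. Qed.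

Lemma stepsize_gap : beta * g = 2 * L / N%:R.
Proof. by rewrite /stepsize; field; rewrite !gt_eqF ?gap_gt0. Qed.

Lemma lnN_ge : 1 / 2 <= L.
Proof.
have := @ln_ge_1BV R _ N0; have : N%:R^-1 <= 2^-1 :> R.
  by rewrite lef_pV2 ?posrE // ler_nat N_gt1.
lra.
Qed.

Lemma rescaled_stepsize_gap : r * (beta * g) = (beta * L1) ^+ 2.
Proof. by rewrite /rescaled_stepsize; field; rewrite gt_eqF // gap_gt0. Qed.

Let g_le : g <= L1. Proof. by rewrite /gap; have := ev2_ge0; lra. Qed.

Lemma stepsize_L1_le : beta * g <= beta * L1 <= r.
Proof.
have g0 := gap_gt0; apply/andP; split; first by rewrite ler_wpM2l // ltW.
have -> : r = beta * (L1 * (L1 / g)).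
  by rewrite /rescaled_stepsize; field; rewrite gt_eqF.
rewrite ler_wpM2l ?(ltW beta_gt0) // -[leLHS]mulr1 ler_wpM2l //.
  by have := gap_gt0; have := g_le; lra.
by rewrite ler_pdivlMr // mul1r.
Qed.

Lemma rescaled_stepsize_gt0 : 0 < r.
Proof.
have /andP[h1 h2] := stepsize_L1_le; apply: lt_le_trans h2.
by apply: lt_le_trans h1; rewrite mulr_gt0 // gap_gt0.
Qed.

Let d2 : 2 <= d%:R :> R. Proof. by case: hlam => h _ _ _; rewrite ler_nat. Qed.

Let delta2 : 0 < delta ^+ 2 < 1 / 4.
Proof.
case/andP: hdelta => h0 h1; rewrite exprn_gt0 //=.
by rewrite expr2 (_ : 1 / 4 = (1 / 2) * (1 / 2)); [apply: ltr_pM => //; exact: ltW|field].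
Qed.

Let b3delta : b3 * delta ^+ 2 < 1 / 4.
Proof.
case/andP: delta2 => h0 h1; apply: le_lt_trans h1.
rewrite -[leRHS]mul1r ler_wpM2r ?(ltW h0) //; apply: le_trans b3_le _.
by rewrite invf_le1 ?mulr_gt0 ?ltr0n // -natrM ler1n.
Qed.

Let rpow := r `^ (1 - 2 * eps0).

Let rpow_lt : d%:R * rpow <= b3 * delta ^+ 2. Proof. exact: hA. Qed.

Lemma rescaled_stepsize_lt : r < 1 / 2.
Proof.
case/andP: heps => e0 e1; have r0 := rescaled_stepsize_gt0.
have p0 : 0 < rpow by rewrite powR_gt0.
have rp : rpow < 1 / 4.
  have : rpow <= d%:R * rpow by rewrite -[leLHS]mul1r ler_wpM2r ?(ltW p0) //; have := d2; lra.
  by have := rpow_lt; have := b3delta; lra.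
have [r1|r1] := leP r 1.
  have h : r <= rpow by apply: ger1_powR; [rewrite r0 r1 | lra].
  lra.
have h : r `^ 0 <= rpow by apply: ler_powR; [exact: ltW | lra].
by rewrite powRr0 in h; lra.
Qed.

Lemma dim_rescaled_stepsize : d%:R * r <= b3 * delta ^+ 2.
Proof.
apply: le_trans rpow_lt; rewrite ler_wpM2l ?ler0n //; case/andP: heps => e0 e1.
by apply: ger1_powR; [rewrite rescaled_stepsize_gt0; have := rescaled_stepsize_lt; lra | lra].
Qed.

Lemma dim_le : d%:R <= b3 * delta ^+ 2 * N%:R.
Proof.
have := dim_rescaled_stepsize; have /andP[h1 h2] := stepsize_L1_le.
have : N%:R^-1 <= r.
  apply: le_trans (le_trans h1 h2); rewrite stepsize_gap -[leLHS]mul1r.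
  by rewrite ler_wpM2r ?invr_ge0 ?(ltW N0) //; have := lnN_ge; lra.
move=> Nr dr; rewrite -ler_pdivrMr //; apply: le_trans dr.
by rewrite ler_wpM2l.
Qed.

Lemma rescaled_time_ge : Num.sqrt N%:R / 8 <= (rescaled_time lam beta 2)%:~R :> R.
Proof.
have h0 : 0 < beta * g by rewrite mulr_gt0 // gap_gt0.
have r0 := rescaled_stepsize_gt0; have r12 := rescaled_stepsize_lt.
have /andP[h1 h2] := stepsize_L1_le.
apply: le_trans (ceil_ge _).
have -> : L1 ^- 2 * g * beta^-1 = r^-1.
  by rewrite /rescaled_stepsize; field; rewrite !gt_eqF ?gap_gt0 //;
    have := gap_gt0; have := g_le; lra.
have lr : 1 / 2 <= ln r^-1.
  by have := @ln_ge_1BV R r^-1; rewrite invr_gt0 invrK => /(_ r0); lra.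
have l1 : 0 < - ln (1 - beta * g).
  by rewrite oppr_gt0; apply: ln_lt0; apply/andP; split; lra.
have l2 : - ln (1 - beta * g) <= 2 * (beta * g).
  have h : 0 < 1 - beta * g by lra.
  have := @ln_ge_1BV R _ h; have : (1 - beta * g)^-1 <= 1 + 2 * (beta * g).
    rewrite -[leLHS]mul1r ler_pdivrMr //.
    have -> : (1 + 2 * (beta * g)) * (1 - beta * g) =
      1 + beta * g * (1 - 2 * (beta * g)) by ring.
    rewrite lerDl mulr_ge0 ?(ltW h0) //; lra.
  lra.
apply: (@le_trans _ _ (1 / (2 * (beta * g)))); last first.
  apply: ler_pM => //; [by rewrite invr_ge0; lra|lra|].
  by rewrite lef_pV2 ?posrE //; lra.
rewrite stepsize_gap.
have L0 : 0 < L by have := lnN_ge; lra.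
have s0 : 0 < Num.sqrt N%:R :> R by rewrite sqrtr_gt0.
have sN : Num.sqrt N%:R ^+ 2 = N%:R :> R by rewrite sqr_sqrtr // ltW.
have -> : 1 / (2 * (2 * L / N%:R)) = N%:R / (4 * L).
  by field; rewrite !gt_eqF.
rewrite ler_pdivlMr ?mulr_gt0 // -[leRHS]sN.
have := ler_wpM2l (ltW s0) (@ln_le_sqrt R _ N0); rewrite expr2; lra.
Qed.

Lemma dim_rescaled_stepsize_ln : d%:R * r * L <= 2 * (b3 * delta ^+ 2).
Proof.
case/andP: hdelta => de0 de1.
have r0 := rescaled_stepsize_gt0; set p := r `^ (- (2 * eps0)).
have s0 : 0 < Num.sqrt N%:R :> R by rewrite sqrtr_gt0.
have sN : Num.sqrt N%:R ^+ 2 = N%:R :> R by rewrite sqr_sqrtr // ltW.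
have ex : Num.sqrt N%:R * expR (- p) <= 1.
  have : 4 * d%:R * (rescaled_time lam beta 2)%:~R * expR (- p) <= delta.
    by have := hB; rewrite /condB mulN1r.
  have : Num.sqrt N%:R <= 4 * d%:R * (rescaled_time lam beta 2)%:~R :> R.
    have h4 : 8 <= 4 * d%:R :> R by have := d2; lra.
    have := ler_pM (ler0n _ 8) _ h4 rescaled_time_ge.
    rewrite divr_ge0 ?(ltW s0) // => /(_ isT); lra.
  move=> h1 h2; apply: le_trans (ler_wpM2r (expR_ge0 _) h1) _; lra.
have Lp : L <= 2 * p.
  have : ln (Num.sqrt N%:R) <= p.
    rewrite -[leRHS]expRK ler_ln ?posrE ?expR_gt0 //.
    by rewrite -[leRHS]mul1r -ler_pdivrMr ?expR_gt0 // -expRN.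
  by rewrite -{2}sN lnXn // mulr2n; lra.
apply: le_trans (ler_wpM2l _ Lp) _; first by rewrite mulr_ge0 // ltW.
have -> : d%:R * r * (2 * p) = 2 * (d%:R * (r * p)) by ring.
rewrite ler_wpM2l //; apply: le_trans rpow_lt.
rewrite le_eqVlt; apply/orP; left; apply/eqP; congr (_ * _).
rewrite /rpow /p -{1}(powRr1 (ltW r0)) -powRD //.
by rewrite (gt_eqF r0) implybT.
Qed.

End step_conditions.

Section linearized_iteration.
Context (R : realType) (n : nat) (dZ dX : measure_display).
Context (TZ : measurableType dZ) (T : measurableType dX).
Context (PZ : probability TZ R) (P : probability T R).
Context (Z : {RV PZ >-> 'cV[R]_n.+1}) (X : nat -> {RV P >-> 'cV[R]_n.+1}).
Context (u0 : {RV P >-> 'cV[R]_n.+1}) (M : 'M[R]_n.+1).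
Context (e : 'I_n.+1 -> 'cV[R]_n.+1) (l : 'I_n.+1 -> R) (beta : R).
Context (init : 'cV[R]_n.+1 -> 'cV[R]_n.+1).
Hypothesis subgZ : standardized_subgaussian Z.
Hypothesis MT : M^T = M.
Hypothesis iidX : iid_copies M Z X.
Hypothesis indepU : independent_of_seq u0 X.
Hypothesis basis_e : orthonormal_basis e.
Hypothesis eig : forall k, M *m M *m e k = l k *: e k.
Hypothesis l_ge0 : forall k, 0 <= l k.
Hypothesis beta_gt0 : 0 < beta.
Hypothesis minit : measurable_fun [set: 'cV[R]_n.+1] init.
Local Notation co k x := (dotv (e k) x).
Local Notation m := (1 + beta * l 0).

(* The update without normalization, divided by its expected gain along the
   leading eigenvector, so that the leading coordinate is a martingale. *)
Definition oja_step (p : 'cV[R]_n.+1 * 'cV[R]_n.+1) : 'cV[R]_n.+1 :=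
  m^-1 *: (p.1 + beta *: (p.2 *m p.2^T *m p.1)).

Definition oja_chain t w := chain X u0 init oja_step t w.

Let m1 : 1 <= m. Proof. by rewrite lerDl mulr_ge0 // ltW. Qed.
Let m0 : m != 0. Proof. by rewrite gt_eqF //; have := m1; lra. Qed.

Lemma measurable_oja_step : measurable_fun setT oja_step.
Proof.
have -> : oja_step = fun p => m^-1 *: (p.1 + (beta * dotv p.2 p.1) *: p.2).
  by apply/funext => p; rewrite /oja_step mul_outer scalerA.
apply: measurable_scalev => //; apply: measurable_addv; first exact: measurable_fst.
apply: measurable_scalev; last exact: measurable_snd.
by apply: measurable_funM => //; apply: measurable_dotv;
  [exact: measurable_snd | exact: measurable_fst].
Qed.

Let mv t : measurable_fun setT (oja_chain t).
Proof. by apply: measurable_chain => //; exact: measurable_oja_step. Qed.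

Lemma measurable_oja_coord t k (D : set T) :
  measurable_fun D (fun w => co k (oja_chain t w)).
Proof. by apply: measurable_funTS; apply: measurable_dotv. Qed.

Let mcoord k : measurable_fun setT (fun x : 'cV[R]_n.+1 => co k x).
Proof. by apply: measurable_dotv => //; exact: measurable_id. Qed.

Let MMe k x : co k (M *m M *m x) = l k * co k x.
Proof. by rewrite dotv_mulmxr trmx_mul MT eig dotvZl. Qed.

Let energy (x : 'cV[R]_n.+1) := \sum_j l j * co j x ^+ 2.

Let energyE x : dotv x (M *m M *m x) = energy x.
Proof.
case: basis_e => _ ->; apply: eq_bigr => j _.
by rewrite MMe mulrCA -expr2.
Qed.

Lemma step_coord_moment k theta t x :
  (\int[P]_w ((co k (oja_step (x, X t w)) - theta) ^+ 2)%:E <=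
   (m ^- 2 * ((co k x - m * theta) ^+ 2 +
      2 * (co k x - m * theta) * (beta * l k * co k x) +
      16 * (beta ^+ 2 * l k) * energy x))%:E)%E.
Proof.
set c := co k x - m * theta.
have eS w : (co k (oja_step (x, X t w)) - theta) ^+ 2 =
    m ^- 2 * (c + dotv (beta *: e k) (X t w) * dotv x (X t w)) ^+ 2.
  rewrite -exprVn -exprMn; congr (_ ^+ 2).
  rewrite /oja_step /= mul_outer dotvZr dotvDr !dotvZr dotvZl /c (dotvC x).
  by field.
under eq_integral do rewrite eS.
have mX a : measurable_fun setT (fun w => dotv a (X t w)).
  by apply: measurable_dotv => //; exact: (measurable_funPT (X t)).
rewrite nnr_integralZl //; last 3 first.
- by rewrite invr_ge0 sqr_ge0.
- apply: measurable_funX; apply: measurable_funD => //.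
  exact: measurable_funM.
- by move=> w _; exact: sqr_ge0.
rewrite [leRHS]EFinM; apply: lee_wpmul2l; first by rewrite lee_fin invr_ge0 sqr_ge0.
apply: le_trans (sample_quadratic_moment subgZ MT iidX t c (beta *: e k) x) _.
rewrite lee_fin (energyE x) !dotvZl !MMe dotvZr.
case: basis_e => -> _; rewrite eqxx mulr1.
by rewrite le_eqVlt; apply/orP; left; apply/eqP; ring.
Qed.

Let oja_chain_step t k theta (g : 'cV[R]_n.+1 -> R) :
  measurable_fun setT g ->
  (forall x, m ^- 2 * ((co k x - m * theta) ^+ 2 +
      2 * (co k x - m * theta) * (beta * l k * co k x) +
      16 * (beta ^+ 2 * l k) * energy x) <= g x) ->
  (\int[P]_w ((co k (oja_chain t.+1 w) - theta) ^+ 2)%:E <=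
   \int[P]_w (g (oja_chain t w))%:E)%E.
Proof.
move=> mg hg.
apply: (markov_integral_le minit measurable_oja_step iidX.1 indepU
  (f := fun x => ((co k x - theta) ^+ 2)%:E) (g := fun x => (g x)%:E)).
- by apply/measurable_EFinP; apply: measurable_funX; apply: measurable_funB.
- by move=> x; rewrite lee_fin sqr_ge0.
- exact/measurable_EFinP.
- by move=> x; apply: le_trans (step_coord_moment k theta t x) _; rewrite lee_fin.
Qed.

Definition coord_moment t k : \bar R :=
  (\int[P]_w (co k (oja_chain t w) ^+ 2)%:E)%E.

Definition leading_variance t : \bar R :=
  (\int[P]_w ((co 0 (oja_chain t w) - 1) ^+ 2)%:E)%E.

Let mco2 t k : measurable_fun setT (fun w => co k (oja_chain t w) ^+ 2).
Proof. by apply: measurable_funX; exact: measurable_oja_coord. Qed.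

Let mint t : measurable_fun setT (fun w => (co 0 (oja_chain t w) - 1) ^+ 2).
Proof.
by apply: measurable_funX; apply: measurable_funB => //; exact: measurable_oja_coord.
Qed.

Let menergy t : measurable_fun setT (fun w => energy (oja_chain t w)).
Proof. by apply: measurable_sum => j; apply: measurable_funM. Qed.

Let energy_ge0 x : 0 <= energy x.
Proof. by apply: sumr_ge0 => j _; rewrite mulr_ge0 // sqr_ge0. Qed.

Let menergyv : measurable_fun setT energy.
Proof.
apply: measurable_sum => j; apply: measurable_funM => //.
exact: measurable_funX.
Qed.

Let energy_moment t : (\int[P]_w (energy (oja_chain t w))%:E =
  \sum_j (l j)%:E * coord_moment t j)%E.
Proof.
rewrite nnr_integral_sum //.
- apply: eq_bigr => j _; rewrite nnr_integralZl // => w _; exact: sqr_ge0.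
- by move=> j; apply: measurable_funM.
- by move=> j w _; rewrite mulr_ge0 // sqr_ge0.
Qed.

Let minv2_le1 : m ^- 2 <= 1.
Proof. by rewrite invf_le1 ?exprn_ege1 // exprn_gt0 //; have := m1; lra. Qed.

Lemma coord_moment_step t k :
  (coord_moment t.+1 k <= (((1 + beta * l k) / m) ^+ 2)%:E * coord_moment t k +
     (16 * beta ^+ 2 * l k)%:E * \sum_j (l j)%:E * coord_moment t j)%E.
Proof.
have b0 : 0 <= 16 * beta ^+ 2 * l k by rewrite mulr_ge0 // mulr_ge0 // sqr_ge0.
rewrite -energy_moment.
rewrite -(nnr_integralZl P measurableT b0 (menergy t) (fun w _ => energy_ge0 _)).
rewrite -(nnr_integralZl P measurableT (sqr_ge0 _) (mco2 t k) (fun w _ => sqr_ge0 _)).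
rewrite -nnr_integralD //; last 4 first.
- exact: measurable_funM.
- exact: measurable_funM.
- by move=> w _; rewrite mulr_ge0 // sqr_ge0.
- by move=> w _; rewrite mulr_ge0.
have -> : coord_moment t.+1 k =
    (\int[P]_w ((co k (oja_chain t.+1 w) - 0) ^+ 2)%:E)%E.
  by apply: eq_integral => w _; rewrite subr0.
apply: (@oja_chain_step t k 0 (fun x =>
  ((1 + beta * l k) / m) ^+ 2 * co k x ^+ 2 + 16 * beta ^+ 2 * l k * energy x)).
  apply: measurable_funD; apply: measurable_funM => //.
  exact: measurable_funX.
move=> x; rewrite mulr0 subr0.
set c := co k _; set E := energy _.
have E0 : 0 <= E by exact: energy_ge0.
have -> : m ^- 2 * (c ^+ 2 + 2 * c * (beta * l k * c) + 16 * (beta ^+ 2 * l k) * E) =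
  m ^- 2 * (1 + 2 * beta * l k) * c ^+ 2 + m ^- 2 * (16 * beta ^+ 2 * l k * E).
  by ring.
apply: lerD.
  rewrite ler_wpM2r ?sqr_ge0 // expr_div_n mulrC.
  rewrite ler_wpM2r ?invr_ge0 ?sqr_ge0 //.
  by have := sqr_ge0 (beta * l k); lra.
by rewrite -[leRHS]mul1r ler_wpM2r // mulr_ge0.
Qed.

Lemma leading_variance_step t :
  (leading_variance t.+1 <= leading_variance t +
     (16 * beta ^+ 2 * l 0)%:E * \sum_j (l j)%:E * coord_moment t j)%E.
Proof.
have b0 : 0 <= 16 * beta ^+ 2 * l 0 by rewrite mulr_ge0 // mulr_ge0 // sqr_ge0.
rewrite -energy_moment.
rewrite -(nnr_integralZl P measurableT b0 (menergy t) (fun w _ => energy_ge0 _)).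
rewrite -nnr_integralD //; last 3 first.
- exact: measurable_funM.
- by move=> w _; exact: sqr_ge0.
- by move=> w _; rewrite mulr_ge0.
apply: (@oja_chain_step t 0 1 (fun x =>
  (co 0 x - 1) ^+ 2 + 16 * beta ^+ 2 * l 0 * energy x)).
  apply: measurable_funD; last exact: measurable_funM.
  by apply: measurable_funX; apply: measurable_funB.
move=> x; rewrite mulr1.
set c := co 0 _; set E := energy _.
have E0 : 0 <= E by exact: energy_ge0.
have -> : m ^- 2 * ((c - m) ^+ 2 + 2 * (c - m) * (beta * l 0 * c) +
    16 * (beta ^+ 2 * l 0) * E) =
  ((c - 1) ^+ 2 - m ^- 2 * (beta * l 0 * c) ^+ 2) +
  m ^- 2 * (16 * beta ^+ 2 * l 0 * E) by field.
apply: lerD; first by rewrite gerBl mulr_ge0 ?invr_ge0 ?sqr_ge0.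
by rewrite -[leRHS]mul1r ler_wpM2r // mulr_ge0.
Qed.

Lemma leading_coord_moment t :
  (coord_moment t 0%R <= 2%:E + 2%:E * leading_variance t)%E.
Proof.
rewrite /leading_variance -nnr_integralZl //; last by move=> w _; exact: sqr_ge0.
have <- : (\int[P]_w 2%:E = 2%:E)%E.
  by rewrite nnr_integral_cst // [X in (_ * X)%E]probability_setT mule1.
rewrite -nnr_integralD //; last 2 first.
- exact: measurable_funM.
- by move=> w _; rewrite mulr_ge0 // sqr_ge0.
apply: nnr_le_integral => //.
- by apply: measurable_funD => //; exact: measurable_funM.
- by move=> w _; exact: sqr_ge0.
- by move=> w _; set c := co 0 _; have := sqr_ge0 (c - 2); lra.
Qed.

End linearized_iteration.

Section moment_bounds.
Context (R : realType) (n N : nat) (l : 'I_n.+1 -> R) (l2 beta r delta b3 : R).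
Local Notation L1 := (l 0).
Local Notation L := (@ln R N%:R).
Local Notation h := (beta * (L1 - l2)).
Local Notation m := (1 + beta * L1).
Local Notation d := (n.+1%:R : R).
Hypothesis l_ge0 : forall k, 0 <= l k.
Hypothesis l_le2 : forall k, k != 0 -> l k <= l2.
Hypothesis l2_ge0 : 0 <= l2.
Hypothesis l2_lt : l2 < L1.
Hypothesis beta_gt0 : 0 < beta.
Hypothesis N1 : (1 < N)%N.
Hypothesis hN : h * N%:R = 2 * L.
Hypothesis L_ge : 1 / 2 <= L.
Hypothesis rh : r * h = (beta * L1) ^+ 2.
Hypothesis L1_le : beta * L1 <= r.
Hypothesis delta01 : 0 < delta < 1 / 2.
Hypothesis b3_gt0 : 0 < b3.
Hypothesis b3_le : b3 <= (1000 * 100)^-1.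
Hypothesis dr : d * r <= b3 * delta ^+ 2.
Hypothesis drL : d * r * L <= 2 * (b3 * delta ^+ 2).
Hypothesis dN : d <= b3 * delta ^+ 2 * N%:R.

Let L1_gt0 : 0 < L1. Proof. exact: le_lt_trans l2_lt. Qed.
Let h_gt0 : 0 < h. Proof. by rewrite mulr_gt0 // subr_gt0. Qed.
Let h_le : h <= beta * L1. Proof. by rewrite ler_wpM2l ?(ltW beta_gt0) //; have := l2_ge0; lra. Qed.
Let m_ge1 : 1 <= m. Proof. by rewrite lerDl mulr_ge0 // ltW. Qed.
Let b3d : b3 * delta ^+ 2 <= b3 * delta / 2.
Proof. by case/andP: delta01 => d0 d1; rewrite expr2; have := mulr_gt0 b3_gt0 d0; nra. Qed.
Let b3' : b3 * (1000 * 100) <= 1.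
Proof. by rewrite -ler_pdivlMr ?mulr_gt0 ?ltr0n // div1r. Qed.
Let r_gt0 : 0 < r.
Proof. by apply: lt_le_trans L1_le; rewrite mulr_gt0. Qed.
Let d_ge1 : 1 <= d. Proof. by rewrite ler1n. Qed.
Let r_dr : r <= d * r.
Proof. by rewrite -[leLHS]mul1r ler_wpM2r // ltW. Qed.
Let b3dd : b3 * delta ^+ 2 * (1000 * 400) <= 1.
Proof.
case/andP: delta01 => d0 d1; have := b3'; have := b3d.
have : b3 * delta <= b3 / 2 by rewrite ler_wpM2l ?(ltW b3_gt0) // -[2^-1]div1r ltW.
lra.
Qed.

Let rho k := ((1 + beta * l k) / m) ^+ 2.
Let rho2 := ((1 + beta * l2) / m) ^+ 2.
Let a := 16 * (r * h).
Let kappa := rho2 + a * d.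
(* Equal to [30 * sqrt (d / y)] for the truncation level [y = (delta / 30)^2 / d]
   of the starting point. *)
Definition initial_energy : R := 900 * d / delta.
Local Notation tau := initial_energy.

Let tau_ge0 : 0 <= tau.
Proof.
by case/andP: delta01 => d0 _; rewrite /tau !mulr_ge0 ?ler0n // invr_ge0 ltW.
Qed.

Let a_gt0 : 0 < a. Proof. by rewrite mulr_gt0 // mulr_gt0. Qed.

Let rho2_ge0 : 0 <= rho2. Proof. exact: sqr_ge0. Qed.

Let kappa_bounds : 1 / 2 <= kappa <= 1 - 3 / 2 * h.
Proof.
have m0 : 0 < m by have := m_ge1; lra.
pose s := h / m.
have s_h : s <= h by rewrite ler_pdivrMr // -[leLHS]mulr1 ler_wpM2l // ltW.
have s0 : 0 < s by rewrite divr_gt0.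
have hs : 99 / 100 * h <= s.
  rewrite ler_pdivlMr // mulrAC -[leRHS]mul1r ler_wpM2r ?(ltW h_gt0) //.
  by have := dr; have := r_dr; have := b3dd; have := L1_le; lra.
have rho2E : rho2 = 1 - 2 * s + s ^+ 2.
  rewrite /rho2 /s (_ : (1 + beta * l2) / m = 1 - h / m); last by field; rewrite gt_eqF.
  by ring.
have ss : s ^+ 2 <= h / 100.
  rewrite expr2; have : s * s <= h * (1 / 100); last by lra.
  apply: ler_pM => //; rewrite ?(ltW s0) //.
  by have := dr; have := r_dr; have := b3dd; have := L1_le; have := h_le; lra.
have ad0 : 0 <= a * d by rewrite mulr_ge0 ?ler0n // ltW.
have ad : a * d <= h / 100.
  rewrite /a (_ : 16 * (r * h) * d = h * (16 * (d * r))); last by ring.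
  by rewrite ler_wpM2l ?(ltW h_gt0) //; have := dr; have := b3dd; lra.
have h1 : h <= 1 / 100.
  by have := dr; have := r_dr; have := b3dd; have := L1_le; have := h_le; lra.
have ss0 := sqr_ge0 s.
by rewrite /kappa rho2E; apply/andP; split; lra.
Qed.

Let kappa_gt0 : 0 < kappa. Proof. by case/andP: kappa_bounds; lra. Qed.

Let kappa_exp : kappa ^+ N <= N%:R ^- 3.
Proof.
have N0 : 0 < N%:R :> R by rewrite ltr0n ltnW.
case/andP: kappa_bounds => _ k1.
have : kappa <= expR (- (3 / 2 * h)).
  by apply: le_trans k1 _; exact: expR_ge1Dx.
move=> kE; have := @lerXn2r R N kappa (expR (- (3 / 2 * h))).
rewrite !nnegrE expR_ge0 (ltW kappa_gt0) => /(_ isT isT kE) h1.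
apply: le_trans h1 _; rewrite -expRM_natl.
have -> : N%:R * - (3 / 2 * h) = - (3%:R * L).
  by rewrite (_ : N%:R * - (3 / 2 * h) = - (3 / 2 * (h * N%:R))); [rewrite hN; field|ring].
by rewrite expRN expRM_natl lnK // posrE.
Qed.

Let growth_small : a * (5 * N%:R + tau / (1 - kappa)) <= delta / 4.
Proof.
case/andP: delta01 => d0 d1; case/andP: kappa_bounds => _ k1.
have k0 : 0 < 1 - kappa by have := h_gt0; lra.
rewrite mulrDr.
have e1 : a * (5 * N%:R) <= 320 * (b3 * delta ^+ 2).
  rewrite /a (_ : 16 * (r * h) * (5 * N%:R) = 80 * r * (h * N%:R)); last by ring.
  rewrite hN; have : r * L <= d * r * L.
    by rewrite ler_wpM2r //; have := L_ge; lra.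
  by have := drL; lra.
have e2 : a * (tau / (1 - kappa)) <= 96 * 100 * (b3 * delta).
  apply: (@le_trans _ _ (a * (tau / (3 / 2 * h)))).
    rewrite ler_wpM2l ?(ltW a_gt0) // ler_wpM2l // lef_pV2 ?posrE //;
      by have := h_gt0; lra.
  rewrite /a /tau.
  rewrite (_ : _ * _ = 96 * 100 * (d * r / delta)); last first.
    by field; rewrite !gt_eqF ?subr_gt0 ?addr_gt0.
  rewrite ler_wpM2l ?ler0n // ler_pdivrMr // -mulrA -expr2; exact: dr.
have : b3 * delta <= delta / (1000 * 100).
  by rewrite mulrC ler_wpM2l // ltW.
by have := b3d; lra.
Qed.

Let tau_le : tau <= N%:R.
Proof.
case/andP: delta01 => d0 d1; rewrite /tau ler_pdivrMr //.
have c0 : 0 <= 900 :> R by exact: ler0n.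
apply: le_trans (ler_wpM2l c0 dN) _.
have -> : 900 * (b3 * delta ^+ 2 * N%:R) = N%:R * (900 * (b3 * delta ^+ 2)) by ring.
apply: ler_wpM2l; first exact: ler0n.
have : b3 * delta <= delta / (1000 * 100) by rewrite mulrC ler_wpM2l // ltW.
by have := b3d; lra.
Qed.

Context (C : nat -> 'I_n.+1 -> \bar R) (V : nat -> \bar R).
Hypothesis C_ge0 : forall t k, (0 <= C t k)%E.
Hypothesis V_ge0 : forall t, (0 <= V t)%E.
Hypothesis V0 : V 0 = 0%E.
Hypothesis C0 : (\sum_(k | k != ord0) C 0 k <= tau%:E)%E.
Hypothesis C_step : forall t k, (C t.+1 k <=
  (((1 + beta * l k) / m) ^+ 2)%:E * C t k +
  (16 * beta ^+ 2 * l k)%:E * \sum_j (l j)%:E * C t j)%E.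
Hypothesis V_step : forall t, (V t.+1 <= V t +
  (16 * beta ^+ 2 * L1)%:E * \sum_j (l j)%:E * C t j)%E.
Hypothesis C_lead : forall t, (C t ord0 <= 2%:E + 2%:E * V t)%E.

Let CV_fin t : (forall k, C t k \is a fin_num) /\ V t \is a fin_num.
Proof.
elim: t => [|t [IC IV]].
  split; last by rewrite V0.
  move=> k; rewrite ge0_fin_numE //.
  have [->|k0] := eqVneq k ord0.
    by apply: le_lt_trans (C_lead 0) _; rewrite V0 mule0 adde0 ltry.
  apply: le_lt_trans (le_lt_trans C0 (ltry _)).
  by rewrite (bigD1 k) //= leeDl // sume_ge0.
have fS : (\sum_j (l j)%:E * C t j)%E \is a fin_num.
  by apply/sum_fin_numP => j _ _; rewrite fin_numM.
have fV : V t.+1 \is a fin_num.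
  rewrite ge0_fin_numE //; apply: le_lt_trans (V_step t) _.
  by rewrite ltey_eq fin_numD IV fin_numM.
split=> // k; rewrite ge0_fin_numE //.
apply: le_lt_trans (C_step t k) _.
by rewrite ltey_eq fin_numD !fin_numM.
Qed.

Lemma moment_bounds : (V N <= (delta / 4)%:E)%E /\
  (\sum_(k | k != ord0) C N k <=
    (160 * beta * L1 * (\sum_(k < n.+1 | k != ord0) l k / (L1 - l k)) +
     2 / N%:R ^+ 2)%:E)%E.
Proof.
pose q t k := fine (C t k); pose D t := fine (V t).
have CE t k : C t k = (q t k)%:E by rewrite /q fineK //; case: (CV_fin t).
have VE t : V t = (D t)%:E by rewrite /D fineK //; case: (CV_fin t).
pose S t := \sum_j l j * q t j.
have SE t : (\sum_j (l j)%:E * C t j = (S t)%:E)%E.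
  by rewrite -sumEFin; apply: eq_bigr => j _; rewrite CE -EFinM.
have q_ge0 t k : 0 <= q t k by rewrite -lee_fin -CE.
have q_step t k : q t.+1 k <= rho k * q t k + 16 * beta ^+ 2 * l k * S t.
  by rewrite -lee_fin -CE EFinD !EFinM -!CE -SE; exact: C_step.
have D_step t : D t.+1 <= D t + 16 * beta ^+ 2 * L1 * S t.
  by rewrite -lee_fin -VE EFinD !EFinM -!VE -SE; exact: V_step.
have q_lead t : q t 0 <= 2 + 2 * D t.
  by rewrite -lee_fin -CE EFinD !EFinM -!VE; exact: C_lead.
pose Q t := \sum_(k | k != ord0) q t k.
have Q0 : Q 0 <= tau.
  by rewrite -lee_fin -sumEFin; under eq_bigr do rewrite -CE.
have D0 : D 0 = 0 by rewrite /D V0.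
have l_le1 k : l k <= L1.
  by have [->//|/l_le2 h1] := eqVneq k 0; have := l2_lt; lra.
have S_le t : S t <= L1 * (q t 0 + Q t).
  rewrite /S (bigD1 ord0) //= mulrDr lerD2l mulr_sumr; apply: ler_sum => k _.
  by rewrite ler_wpM2r.
have bb0 : 0 <= 16 * beta ^+ 2 by rewrite mulr_ge0 // sqr_ge0.
have aE : a = 16 * beta ^+ 2 * L1 * L1 by rewrite /a rh; ring.
have rho_le k : k != 0 -> rho k <= rho2.
  move=> k0; rewrite /rho /rho2 ler_pXn2r ?nnegrE //; first last.
  - by rewrite divr_ge0 ?addr_ge0 // ?mulr_ge0 ?(ltW beta_gt0) //; have := m_ge1; lra.
  - by rewrite divr_ge0 ?addr_ge0 // ?mulr_ge0 ?(ltW beta_gt0) //; have := m_ge1; lra.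
  rewrite ler_wpM2r ?invr_ge0 //; first by have := m_ge1; lra.
  by rewrite lerD2l ler_wpM2l ?(ltW beta_gt0) // l_le2.
have suml : \sum_(k < n.+1 | k != ord0) l k <= d * L1.
  apply: (@le_trans _ _ (\sum_(k < n.+1) L1)).
    rewrite big_mkcond /=; apply: ler_sum => k _; case: ifP => // _; exact: ltW.
  by rewrite sumr_const card_ord mulr_natl.
have S_ge0 t : 0 <= S t by apply: sumr_ge0 => k _; rewrite mulr_ge0.
have Q_step t : Q t.+1 <= kappa * Q t + a * d * q t 0.
  apply: (@le_trans _ _ (\sum_(k | k != ord0)
      (rho2 * q t k + 16 * beta ^+ 2 * l k * S t))).
    apply: ler_sum => k k0; apply: le_trans (q_step t k) _.
    by rewrite lerD2r ler_wpM2r // rho_le.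
  rewrite big_split /= -mulr_sumr -/(Q t) -mulr_suml -mulr_sumr.
  have : 16 * beta ^+ 2 * (\sum_(k < n.+1 | k != ord0) l k) * S t <=
      16 * beta ^+ 2 * (d * L1) * (L1 * (q t 0 + Q t)).
    apply: ler_pM => //; last by rewrite ler_wpM2l.
    by rewrite mulr_ge0 // sumr_ge0.
  by rewrite /kappa aE; lra.
have D_step' t : D t.+1 <= D t + a * (q t 0 + Q t).
  apply: le_trans (D_step t) _; rewrite lerD2l aE -[leRHS]mulrA ler_wpM2l //.
  by rewrite mulr_ge0 // ltW.
case/andP: (delta01) => de0 de1; case/andP: kappa_bounds => k_lo k_hi.
have k01 : 0 < kappa < 1 by rewrite kappa_gt0 /=; have := h_gt0; lra.
have ad4 : kappa + 4 * (a * d) <= 1.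
  have : a * d <= h / 100.
    rewrite /a (_ : 16 * (r * h) * d = h * (16 * (d * r))); last by ring.
    by rewrite ler_wpM2l ?(ltW h_gt0) //; have := dr; have := b3dd; lra.
  by have := h_gt0; lra.
have small1 : a * (5 * N%:R + tau / (1 - kappa)) <= 1.
  by have := growth_small; lra.
have ad0 : 0 <= a * d by rewrite mulr_ge0 ?ler0n // ltW.
have main := coupled_recursion k01 (ltW a_gt0) ad0 tau_ge0 ad4 small1 Q0 D0
  Q_step D_step' q_lead.
have [DN _] := main N (leqnn N).
split; first by rewrite VE lee_fin; exact: le_trans growth_small.
under eq_bigr do rewrite CE.
rewrite sumEFin lee_fin.
have kN : 0 <= kappa ^+ N by rewrite exprn_ge0 // ltW.
pose b k := 16 * beta ^+ 2 * l k * L1.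
have b0 k : 0 <= b k by rewrite /b mulr_ge0 ?(ltW L1_gt0) // mulr_ge0.
have m0 : 0 < m by have := m_ge1; lra.
have rho1 k : k != 0 -> beta * (L1 - l k) / 2 <= 1 - rho k.
  move=> k0; pose s := beta * (L1 - l k) / m.
  have lk := l_le2 k0; have lk1 : 0 < L1 - l k by have := l2_lt; lra.
  have s0 : 0 < s by rewrite divr_gt0 // mulr_gt0.
  have s1 : s <= 1.
    rewrite ler_pdivrMr // mul1r mulrBr; have := l_ge0 k.
    by have : 0 <= beta * l k; [rewrite mulr_ge0 // ltW | lra].
  have -> : rho k = (1 - s) ^+ 2.
    by rewrite /rho /s; congr (_ ^+ 2); field; rewrite gt_eqF.
  have : beta * (L1 - l k) / 2 <= s.
    rewrite ler_wpM2l //; first by rewrite mulr_ge0 // ltW.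
    rewrite lef_pV2 ?posrE //.
    by have := dr; have := r_dr; have := b3dd; have := L1_le; lra.
  have : s * s <= s by rewrite -[leRHS]mulr1 ler_wpM2l // ltW.
  by rewrite expr2; lra.
have qN k : k != 0 -> q N k <= kappa ^+ N * q 0 k +
    b k * (5 / (1 - rho k) + tau * (N%:R * kappa ^+ N / kappa)).
  move=> k0; apply: (@forced_recursion _ (q ^~ k)) => //.
  - exact: sqr_ge0.
  - have := rho1 k k0; have lk := l_le2 k0.
    by have : 0 < beta * (L1 - l k); [rewrite mulr_gt0 // subr_gt0; have := l2_lt; lra | lra].
  - by apply: le_trans (rho_le k k0) _; rewrite /kappa lerDl.
  move=> t tN; apply: le_trans (q_step t k) _; rewrite lerD2l.
  have [_ h1] := main t (ltnW tN).
  apply: le_trans (ler_wpM2l _ (S_le t)) _; first by rewrite mulr_ge0.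
  by rewrite mulrA ler_wpM2l // -/(b k).
apply: le_trans (ler_sum _ qN) _.
rewrite big_split /= -mulr_sumr -/(Q 0).
under eq_bigr do rewrite mulrDr.
rewrite big_split /= -mulr_suml.
have t1 : \sum_(k | k != ord0) b k * (5 / (1 - rho k)) <=
    160 * beta * L1 * (\sum_(k < n.+1 | k != ord0) l k / (L1 - l k)).
  rewrite mulr_sumr; apply: ler_sum => k k0.
  have lk := l_le2 k0; have lk1 : 0 < L1 - l k by have := l2_lt; lra.
  apply: (@le_trans _ _ (b k * (5 / (beta * (L1 - l k) / 2)))).
    rewrite ler_wpM2l // ler_wpM2l // lef_pV2 ?posrE.
    - exact: rho1.
    - by apply: lt_le_trans (rho1 k k0); rewrite divr_gt0 // mulr_gt0.
    - by rewrite divr_gt0 // mulr_gt0.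
  by rewrite le_eqVlt; apply/orP; left; apply/eqP; rewrite /b; field; rewrite !gt_eqF.
have t2 : (\sum_(k < n.+1 | k != ord0) b k) * (tau * (N%:R * kappa ^+ N / kappa)) <=
    kappa ^+ N * tau.
  have sb : \sum_(k < n.+1 | k != ord0) b k <= a * d.
    rewrite /b -mulr_suml -mulr_sumr aE.
    have := ler_wpM2l bb0 suml => /(ler_wpM2r (ltW L1_gt0)); lra.
  apply: (@le_trans _ _ (a * d * (tau * (N%:R * kappa ^+ N / kappa)))).
    by rewrite ler_wpM2r // !mulr_ge0 ?invr_ge0 ?ler0n // ltW.
  have -> : a * d * (tau * (N%:R * kappa ^+ N / kappa)) =
      (16 * (d * r) * (h * N%:R)) / kappa * (kappa ^+ N * tau).
    by rewrite /a; ring.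
  rewrite -[leRHS]mul1r; apply: ler_wpM2r; first exact: mulr_ge0.
  rewrite (ler_pdivrMr _ _ kappa_gt0) mul1r hN.
  by have := drL; have := b3dd; lra.
have t3 : kappa ^+ N * tau <= 1 / N%:R ^+ 2.
  have N0 : 0 < N%:R :> R by rewrite ltr0n ltnW.
  apply: (@le_trans _ _ (N%:R ^- 3 * N%:R)); first exact: ler_pM.
  by rewrite le_eqVlt; apply/orP; left; apply/eqP; field; rewrite gt_eqF.
have t4 := ler_wpM2l kN Q0.
lra.
Qed.

End moment_bounds.

Section tangent.
Context (R : realType) (n : nat) (e : 'I_n.+1 -> 'cV[R]_n.+1).
Hypothesis basis_e : orthonormal_basis e.
Local Notation co k x := (dotv (e k) x).

Lemma parseval v : dotv v v = co ord0 v ^+ 2 + \sum_(k | k != ord0) co k v ^+ 2.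
Proof.
case: basis_e => _ ->; rewrite (bigD1 ord0) //= -expr2; congr (_ + _).
Qed.

Lemma tan2_angle_basis (c : R) u v : dotv u u = 1 -> v = c *: u -> c != 0 ->
  co ord0 v != 0 ->
  tan2_angle u (e ord0) =
  ((\sum_(k | k != ord0) co k v ^+ 2) / co ord0 v ^+ 2)%:E.
Proof.
move=> uu -> c0; rewrite dotvZr mulf_eq0 negb_or c0 /= => x0.
under eq_bigr do rewrite dotvZr exprMn.
rewrite -mulr_sumr exprMn.
have := parseval u; rewrite uu => pu.
have s0 : 0 <= \sum_(k | k != ord0) co k u ^+ 2.
  by apply: sumr_ge0 => k _; exact: sqr_ge0.
have x1 : co ord0 u \in `[-1, 1].
  rewrite in_itv /= -ler_norml -(ler_pXn2r (n := 2)) ?nnegrE // expr1n.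
  by rewrite real_normK ?num_real //; lra.
rewrite /tan2_angle /angle (dotvC u) acosK // (negbTE x0); congr EFin.
rewrite /tan expr_div_n acosK // sin2cos2 acosK //.
have -> : \sum_(k | k != ord0) co k u ^+ 2 = 1 - co ord0 u ^+ 2 by lra.
by field; rewrite x0 c0.
Qed.

End tangent.

Section normalized_iteration.
Context (R : realType) (n : nat) (beta m : R) (x : nat -> 'cV[R]_n).
Hypothesis beta_gt0 : 0 < beta.
Hypothesis m_neq0 : m != 0.

Lemma online_pca_collinear (v : nat -> 'cV[R]_n) (u0 : 'cV[R]_n) (c : R) :
  dotv u0 u0 = 1 -> c != 0 -> v 0 = c *: u0 ->
  (forall t, v t.+1 = m^-1 *: (v t + beta *: (x t *m (x t)^T *m v t))) ->
  forall t, dotv (online_pca beta x u0 t) (online_pca beta x u0 t) = 1 /\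
    exists2 c', c' != 0 & v t = c' *: online_pca beta x u0 t.
Proof.
move=> uu c0 v0 vS; elim=> [|t [ut [c' c'0 vt]]]; first by split=> //; exists c.
set u := online_pca _ _ _ t in ut vt.
pose w := u + beta *: (x t *m (x t)^T *m u).
have uw : 0 < dotv u w.
  rewrite /w mul_outer dotvDr ut !dotvZr (dotvC u) -expr2.
  by rewrite ltr_wpDr // mulr_ge0 ?sqr_ge0 // ltW.
have ww : 0 < dotv w w.
  rewrite lt_def dotv_ge0 dotv_eq0 andbT; apply/eqP => w0.
  by move: uw; rewrite w0 dotv0r ltxx.
have e0 : 0 < enorm w by rewrite sqrtr_gt0.
rewrite /= -/u -/w; split.
  by rewrite /normalize dotvZl dotvZr mulrA -invfM -expr2 sqr_enorm mulVf ?gt_eqF.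
exists (m^-1 * c' * enorm w); first by rewrite !mulf_neq0 ?invr_eq0 // gt_eqF.
have -> : (m^-1 * c' * enorm w) *: normalize w = (m^-1 * c') *: w.
  by rewrite /normalize scalerA mulfK // gt_eqF.
rewrite vS vt -scalerA; congr (_ *: _).
by rewrite /w scalerDr -scalemxAr !scalerA (mulrC beta).
Qed.

End normalized_iteration.

Section spherical_start.
Context (R : realType) (n : nat) (mu : probability 'cV[R]_n.+1 R).
Context (e : 'I_n.+1 -> 'cV[R]_n.+1) (y : R).
Hypothesis mu_unif : uniform_on_sphere mu.
Hypothesis basis_e : orthonormal_basis e.
Hypothesis y_gt0 : 0 < y.
Hypothesis y_le : y <= 1 / 2.
Local Notation co k x := (dotv (e k) x).
Local Notation S := (@usphere R n.+1).

(* The truncation level [y] makes [1 / <u, u*>^2] integrable: off [good_start] the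
   chain is restarted from [u*]. *)
Definition good_start : set 'cV[R]_n.+1 := [set u | S u /\ y <= co ord0 u ^+ 2].

Definition oja_init (u : 'cV[R]_n.+1) : 'cV[R]_n.+1 :=
  e ord0 + \1_good_start u *: ((co ord0 u)^-1 *: u + -1 *: e ord0).

Let mco k D : measurable_fun D (fun u : 'cV[R]_n.+1 => co k u).
Proof.
by apply: measurable_funTS; apply: measurable_dotv => //; exact: measurable_id.
Qed.

Lemma measurable_good_start : measurable good_start.
Proof.
have -> : good_start = S `&` ([set: 'cV[R]_n.+1] `&` [set u | y <= co ord0 u ^+ 2]).
  by rewrite setTI.
apply: measurableI; first exact: measurable_usphere.
rewrite -[X in _ `&` X]/((fun u => y <= co ord0 u ^+ 2) @^-1` [set true]).
apply: measurable_fun_ler => //; exact: measurable_funX.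
Qed.

Lemma measurable_oja_init : measurable_fun setT oja_init.
Proof.
apply: measurable_addv => //; apply: measurable_scalev.
  by apply: measurable_indic; exact: measurable_good_start.
apply: measurable_addv => //; apply: measurable_scalev; last exact: measurable_id.
exact: measurable_invr.
Qed.

Lemma oja_init_good u : good_start u -> oja_init u = (co ord0 u)^-1 *: u.
Proof.
move=> Gu; rewrite /oja_init indicE mem_set // scale1r scaleN1r.
by rewrite addrC subrK.
Qed.

Lemma oja_init_bad u : ~ good_start u -> oja_init u = e ord0.
Proof. by move=> Gu; rewrite /oja_init indicE memNset // scale0r addr0. Qed.

Lemma good_start_neq0 u : good_start u -> co ord0 u != 0.
Proof.
case=> _; apply: contraTneq => ->; rewrite expr0n /= -ltNge //.
Qed.

Lemma oja_init_lead u : co ord0 (oja_init u) = 1.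
Proof.
have [Gu|Gu] := pselect (good_start u).
  by rewrite oja_init_good // dotvZr mulVf // good_start_neq0.
by rewrite oja_init_bad //; case: basis_e => -> _; rewrite eqxx.
Qed.

Let minv D : measurable_fun D (fun u => (y + co ord0 u ^+ 2)^-1).
Proof.
apply: measurable_funTS; apply: measurable_invr; apply: measurable_funD => //.
exact: measurable_funX.
Qed.

Let inv_ge0 u : 0 <= (y + co ord0 u ^+ 2)^-1.
Proof. by rewrite invr_ge0 addr_ge0 ?sqr_ge0 // ltW. Qed.

Lemma bad_start_measure :
  (mu (S `\` good_start) <= (30 * Num.sqrt (n.+1%:R * y))%:E)%E.
Proof.
have mS := @measurable_usphere R n.+1; have mG := measurable_good_start.
have mSG : measurable (S `\` good_start) by exact: measurableD.
have y2 : 0 <= 2 * y by rewrite mulr_ge0 // ltW.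
rewrite -[X in mu X](setIidl (@subDsetl _ S good_start)) -integral_indic //.
apply: le_trans (_ : (\int[mu]_(u in S) (2 * y * (y + co ord0 u ^+ 2)^-1)%:E <= _))%E.
  apply: nnr_le_integral => //.
  - exact: measurable_funM.
  - move=> u Su; rewrite indicE; case: (boolP (u \in _)) => [|_]; last first.
      by rewrite mulr_ge0.
    rewrite inE => -[_ /not_andP[//|/negP]]; rewrite -ltNge => cy.
    have c0 := sqr_ge0 (co ord0 u).
    by rewrite mulr1n ler_pdivlMr; have := y_gt0; lra.
rewrite nnr_integralZl //.
apply: le_trans (lee_wpmul2l _ (uniform_inverse_moment mu_unif _ basis_e ord0 y_gt0 y_le)) _ => //.
rewrite -EFinM lee_fin.
have -> : n.+1%:R * y = (n.+1%:R / y) * y ^+ 2 by field; rewrite gt_eqF.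
rewrite [X in _ <= 30 * X]sqrtrM ?divr_ge0 ?ler0n ?(ltW y_gt0) //.
by rewrite sqrtr_sqr gtr0_norm //; lra.
Qed.

Lemma oja_init_energy :
  (\sum_(k | k != ord0) \int[mu]_u (co k (oja_init u) ^+ 2)%:E <=
   (30 * Num.sqrt (n.+1%:R / y))%:E)%E.
Proof.
have mS := @measurable_usphere R n.+1.
have mi k : measurable_fun setT (fun u => co k (oja_init u) ^+ 2).
  by apply: measurable_funX; apply: measurable_dotv => //; exact: measurable_oja_init.
rewrite -nnr_integral_sum //; last by move=> k u _; exact: sqr_ge0.
have -> : (\int[mu]_u (\sum_(k | k != ord0) co k (oja_init u) ^+ 2)%:E =
    \int[mu]_(u in S) (\sum_(k | k != ord0) co k (oja_init u) ^+ 2)%:E)%E.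
  rewrite [RHS]integral_mkcond; apply: eq_integral => u _; rewrite patchE.
  case: ifPn => // /negP; rewrite inE => Su.
  rewrite big1 // => k k0; rewrite oja_init_bad; last by case.
  by case: basis_e => -> _; rewrite (negbTE k0) expr0n.
apply: le_trans (_ : (\int[mu]_(u in S) (2 * (y + co ord0 u ^+ 2)^-1)%:E <= _))%E.
  apply: nnr_le_integral => //.
  - apply: measurable_funTS; under eq_fun do rewrite -big_filter.
    exact: measurable_sum.
  - exact: measurable_funM.
  - by move=> u _; apply: sumr_ge0 => k _; exact: sqr_ge0.
  move=> u Su; have [Gu|Gu] := pselect (good_start u); last first.
    rewrite big1 ?mulr_ge0 // => k k0; rewrite oja_init_bad //.
    by case: basis_e => -> _; rewrite (negbTE k0) expr0n.
  rewrite oja_init_good //; under eq_bigr do rewrite dotvZr exprMn.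
  rewrite -mulr_sumr; have := parseval basis_e u.
  have c0 := good_start_neq0 Gu; have [/enorm_eq1 -> yc] := Gu.
  have c20 : 0 < co ord0 u ^+ 2 by rewrite lt_def sqr_ge0 sqrf_eq0 c0.
  move=> h; have -> : \sum_(k | k != ord0) co k u ^+ 2 = 1 - co ord0 u ^+ 2 by lra.
  rewrite exprVn ler_pdivlMr; last by have := y_gt0; lra.
  rewrite -mulrA ler_pdivrMl // mulrC.
  have c21 : 0 <= 1 - co ord0 u ^+ 2.
    suff <- : \sum_(k | k != ord0) co k u ^+ 2 = 1 - co ord0 u ^+ 2.
      by apply: sumr_ge0 => k _; exact: sqr_ge0.
    by lra.
  apply: (@le_trans _ _ ((2 * co ord0 u ^+ 2) * 1)); last by lra.
  by apply: ler_pM => //; have := y_gt0; lra.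
rewrite nnr_integralZl //.
apply: le_trans (lee_wpmul2l _ (uniform_inverse_moment mu_unif _ basis_e ord0 y_gt0 y_le)) _ => //.
by rewrite -EFinM lee_fin; lra.
Qed.

End spherical_start.

Definition rate_constant (R : realType) : R := (1000 * 100)^-1.

Lemma quarter_le_sqr (R : realFieldType) (c : R) : 1 / 2 <= c -> 1 / 4 <= c ^+ 2.
Proof. by move=> h; nra. Qed.

Lemma online_pca_tan2_bound (R : realType) (n : nat) (lam : n.+1.-tuple R)
    (Sigma Sigma_half : 'M[R]_n.+1) (ustar : 'cV[R]_n.+1)
    (dZ : measure_display) (TZ : measurableType dZ)
    (PZ : probability TZ R) (Z : {RV PZ >-> 'cV[R]_n.+1})
    (dX : measure_display) (T : measurableType dX)
    (P : probability T R) (X : nat -> {RV P >-> 'cV[R]_n.+1})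
    (u0 : {RV P >-> 'cV[R]_n.+1}) (eps0 : R) (N : nat) (delta : R) :
  pca_spectrum lam ->
  psdmx Sigma -> has_spectrum Sigma lam ->
  psdmx Sigma_half -> Sigma_half *m Sigma_half = Sigma ->
  enorm ustar = 1 -> Sigma *m ustar = ev lam 1 *: ustar ->
  standardized_subgaussian Z ->
  iid_copies Sigma_half Z X ->
  uniform_on_sphere (distribution P u0) ->
  independent_of_seq u0 X ->
  0 < eps0 < 8^-1 -> 0 < delta < 1 / 2 ->
  0 < stepsize lam N ->
  condA (rate_constant R) eps0 lam N delta -> condB 1 eps0 lam N delta ->
  exists A : set T,
  [/\ measurable A, ((1 - 2 * delta)%:E <= P A)%E &
    (\int[P]_(w in A)
       tan2_angle (online_pca (stepsize lam N) (X ^~ w) (u0 w) N) ustar <=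
     (1280 * (ev lam 1 / gap lam * spectral_sum lam * (ln N%:R / N%:R)) +
      4 / N%:R)%:E)%E].
Proof.
move=> hlam [ST _] cS [MT _] MM us1 Sus subgZ iidX unifU indepU heps hdelta b0 hA hB.
have [e [basis_e e0 eigS]] := eigenbasis ST cS (proj1 (enorm_eq1 ustar) us1) Sus.
have b30 : 0 < rate_constant R by rewrite invr_gt0 mulr_gt0 ?ltr0n.
have b3le : rate_constant R <= (1000 * 100)^-1 by [].
pose l (k : 'I_n.+1) := lam`_k.
have l_ev (k : 'I_n.+1) : l k = ev lam k.+1 by [].
have eig k : Sigma_half *m Sigma_half *m e k = l k *: e k by rewrite MM.
have l20 : 0 <= ev lam 2 := ev2_ge0 hlam.
have g0 := gap_gt0 hlam.
have l2lt : ev lam 2 < l ord0 by have := g0; rewrite subr_gt0.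
have hl k : k != ord0 -> 0 <= l k <= ev lam 2.
  move=> k0; have := @pca_spectrum_bounds R n.+1 lam k.+1 hlam; apply.
  by rewrite ltnS lt0n k0 ltn_ord.
have l_ge0 k : 0 <= l k.
  have [->|/hl /andP[]//] := eqVneq k ord0.
  by apply: ltW; apply: le_lt_trans l2lt.
have l_le2 k : k != ord0 -> l k <= ev lam 2 by move=> /hl /andP[].
set beta := stepsize lam N in b0 *.
have N1 : (1 < N)%N := N_gt1 b0.
have N0 : 0 < N%:R :> R by rewrite ltr0n ltnW.
case/andP: (hdelta) => de0 de1.
have d0 : 0 < n.+1%:R :> R by rewrite ltr0n.
pose y := (delta / 30) ^+ 2 / n.+1%:R.
have y0 : 0 < y by rewrite divr_gt0 // exprn_gt0 // divr_gt0.
have y12 : y <= 1 / 2.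
  rewrite ler_pdivrMr //.
  have : delta / 30 * (delta / 30) <= 1 / 2 * 1.
    by apply: ler_pM; rewrite ?divr_ge0 ?(ltW de0) //; lra.
  have : 1 <= n.+1%:R :> R by rewrite ler1n.
  by rewrite expr2; lra.
have sq1 : Num.sqrt (n.+1%:R * y) = delta / 30.
  by rewrite /y mulrC divfK ?gt_eqF // sqrtr_sqr ger0_norm // divr_ge0 // ltW.
have sq2 : Num.sqrt (n.+1%:R / y) = 30 * n.+1%:R / delta.
  rewrite (_ : _ / y = (30 * n.+1%:R / delta) ^+ 2); last first.
    by rewrite /y; field; rewrite !gt_eqF.
  by rewrite sqrtr_sqr ger0_norm // divr_ge0 ?(ltW de0) // mulr_ge0.
pose init := oja_init e y.
have minit : measurable_fun setT init by exact: measurable_oja_init.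
pose v t w := @oja_chain R n dX T P X u0 l beta init t w.
pose C t k := coord_moment X u0 e l beta init t k.
pose V t := leading_variance X u0 e l beta init t.
have C_ge0 t k : (0 <= C t k)%E.
  by apply: integral_ge0 => w _; rewrite lee_fin sqr_ge0.
have V_ge0 t : (0 <= V t)%E.
  by apply: integral_ge0 => w _; rewrite lee_fin sqr_ge0.
have V0 : V 0%N = 0%E.
  rewrite /V /leading_variance integral0_eq // => w _.
  by rewrite /oja_chain /= oja_init_lead // subrr expr0n.
have C0 : (\sum_(k | k != ord0) C 0%N k <= (initial_energy n delta)%:E)%E.
  have := oja_init_energy unifU basis_e y0 y12.
  rewrite sq2 (_ : 30 * (30 * _ / delta) = initial_energy n delta); last first.
    by rewrite /initial_energy; field; rewrite gt_eqF.
  apply: le_trans; rewrite le_eqVlt; apply/orP; left; apply/eqP.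
  apply: eq_bigr => k _.
  rewrite (ge0_integral_distribution u0 (f := fun u => (dotv (e k) (init u) ^+ 2)%:E)) //.
  - apply/measurable_EFinP; apply: measurable_funX; apply: measurable_dotv => //.
  - by move=> u; rewrite lee_fin sqr_ge0.
have r_gap := rescaled_stepsize_gap N hlam.
have /andP[_ L1r] := stepsize_L1_le hlam b0.
have hN : beta * gap lam * N%:R = 2 * @ln R N%:R.
  by rewrite (stepsize_gap hlam b0) divfK // gt_eqF.
have [VN CN] := @moment_bounds R n N l (ev lam 2) beta (rescaled_stepsize lam N)
  delta (rate_constant R) l_ge0 l_le2 l20 l2lt b0 N1 hN (lnN_ge b0) r_gap L1r
  hdelta b30 b3le
  (dim_rescaled_stepsize hlam heps hdelta b3le b0 hA)
  (dim_rescaled_stepsize_ln hlam heps hdelta b3le b0 hA hB)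
  (dim_le hlam heps hdelta b3le b0 hA)
  C V C_ge0 V_ge0 V0 C0
  (fun t k => coord_moment_step subgZ MT iidX indepU basis_e eig l_ge0 b0 minit t k)
  (fun t => leading_variance_step subgZ MT iidX indepU basis_e eig l_ge0 b0 minit t)
  (leading_coord_moment X u0 e l beta minit).
have mco k t (D : set T) : measurable_fun D (fun w => dotv (e k) (v t w)).
  by rewrite /v; apply: measurable_oja_coord.
pose G := u0 @^-1` good_start e y.
pose H := [set w | 1 / 2 <= dotv (e ord0) (v N w)].
have mG : measurable G.
  rewrite -[X in measurable X]setTI; apply: measurable_funPT => //.
  exact: measurable_good_start.
have mH : measurable H.
  rewrite -[X in measurable X]setTI.
  rewrite -[X in _ `&` X]/((fun w => 1 / 2 <= dotv (e ord0) (v N w)) @^-1` [set true]).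
  by apply: measurable_fun_ler.
exists (G `&` H); split; first exact: measurableI.
  have PG : (1 <= P G + delta%:E)%E.
    have := bad_start_measure unifU basis_e y0 y12.
    rewrite sq1 (_ : 30 * (delta / 30) = delta); last by field.
    move=> hbad; have [uS _] := unifU.
    rewrite -[leLHS]uS.
    apply: le_trans (_ : (distribution P u0 (good_start e y `|`
      (@usphere R n.+1 `\` good_start e y)) <= _)%E).
      apply: le_measure; rewrite ?inE.
      - exact: measurable_usphere.
      - apply: measurableU; first exact: measurable_good_start.
        by apply: measurableD; [exact: measurable_usphere | exact: measurable_good_start].
      - by move=> u Su /=; have [?|?] := pselect (good_start e y u); [left | right].
    apply: le_trans (measureU2 _ _ _) _.
    - exact: measurable_good_start.
    - by apply: measurableD; [exact: measurable_usphere | exact: measurable_good_start].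
    - exact: leeD.
  have PH : (P (~` H) <= delta%:E)%E.
    have mHc : measurable (~` H) by exact: measurableC.
    rewrite -[~` H]setIT -integral_indic //.
    apply: le_trans (_ : (4%:E * V N <= _)%E); last first.
      apply: le_trans (lee_wpmul2l _ VN) _; first by rewrite lee_fin.
      by rewrite -EFinM lee_fin; lra.
    have mV : measurable_fun setT (fun w => (dotv (e ord0) (v N w) - 1) ^+ 2).
      by apply: measurable_funX; apply: measurable_funB.
    rewrite -[V N]/(\int[P]_w ((dotv (e ord0) (v N w) - 1) ^+ 2)%:E)%E.
    rewrite -nnr_integralZl //; last by move=> w _; exact: sqr_ge0.
    apply: nnr_le_integral => //.
    - exact: measurable_funM.
    - move=> w _; rewrite indicE; case: (boolP (w \in _)) => [|_]; last first.
        by rewrite mulr_ge0 // sqr_ge0.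
      rewrite inE /= => /negP; rewrite -ltNge mulr1n.
      set c := dotv _ _ => c12.
      rewrite -(opprB 1 c) sqrrN -ler_pdivrMl // mulrC.
      by apply: quarter_le_sqr; rewrite lerBrDr -lerBrDl (le_trans (ltW c12)) //; lra.
  have PA : (1 <= P (G `&` H) + delta%:E + delta%:E)%E.
    apply: le_trans PG _; rewrite leeD2r //.
    apply: le_trans (_ : (P (G `&` H) + P (~` H) <= _)%E); last exact: leeD2l.
    apply: le_trans (measureU2 _ _ _) => //.
    - apply: le_measure; rewrite ?inE //.
      + by apply: measurableU; [exact: measurableI | exact: measurableC].
      + by move=> w Gw /=; have [?|?] := pselect (H w); [left | right].
    - exact: measurableI.
    - exact: measurableC.
  have Pfin : P (G `&` H) \is a fin_num.
    by apply: fin_num_measure; exact: measurableI.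
  by move: PA; rewrite -(fineK Pfin) -!EFinD !lee_fin; lra.
have coll w : G w -> exists2 c, c != 0 & v N w = c *: online_pca beta (X ^~ w) (u0 w) N /\
    dotv (online_pca beta (X ^~ w) (u0 w) N) (online_pca beta (X ^~ w) (u0 w) N) = 1.
  move=> Gw; have c0 := good_start_neq0 y0 Gw.
  have m0 : 1 + beta * l 0 != 0.
    by rewrite gt_eqF // ltr_wpDr // mulr_ge0 // ltW.
  have [||||uN [c cn0 vN]] := @online_pca_collinear R n.+1 beta (1 + beta * l 0)
    (X ^~ w) b0 m0 (v ^~ w) (u0 w) (dotv (e ord0) (u0 w))^-1 _ _ _ _ N.
  - by case: Gw => /enorm_eq1.
  - by rewrite invr_eq0.
  - exact: oja_init_good.
  - by [].
  by exists c.
pose F w := (\sum_(k | k != ord0) dotv (e k) (v N w) ^+ 2).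
have mF D : measurable_fun D F.
  rewrite /F; under eq_fun do rewrite -big_filter.
  by apply: measurable_sum => k; exact: measurable_funX.
have F0 w : 0 <= F w by apply: sumr_ge0 => k _; exact: sqr_ge0.
have -> : (\int[P]_(w in G `&` H)
    tan2_angle (online_pca beta (X ^~ w) (u0 w) N) ustar =
    \int[P]_(w in G `&` H) (F w / dotv (e ord0) (v N w) ^+ 2)%:E)%E.
  apply: eq_integral => w; rewrite inE => -[Gw Hw].
  have [c cn0 [vN uN]] := coll w Gw.
  rewrite -e0 (tan2_angle_basis basis_e uN vN) // gt_eqF //.
  by apply: lt_le_trans Hw; lra.
have mGH : measurable (G `&` H) by exact: measurableI.
apply: (@le_trans _ _ (\int[P]_(w in G `&` H) (4 * F w)%:E)%E).
  apply: nnr_le_integral => //.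
  - apply: measurable_funM => //; apply: measurable_funTS.
    by apply: measurable_invr; apply: measurable_funX.
  - exact: measurable_funM.
  - by move=> w _; rewrite divr_ge0 // sqr_ge0.
  move=> w [_ Hw]; have c2 : 1 / 2 <= dotv (e ord0) (v N w) by [].
  have cc := quarter_le_sqr c2.
  have cc0 : 0 < dotv (e ord0) (v N w) ^+ 2 by apply: lt_le_trans cc.
  by rewrite ler_pdivrMr // mulrAC -[leLHS]mul1r ler_wpM2r // mulrC -ler_pdivrMr.
apply: (@le_trans _ _ (\int[P]_w (4 * F w)%:E)%E).
  apply: ge0_subset_integral => //.
  - by apply/measurable_EFinP; exact: measurable_funM.
  - by move=> w _; rewrite lee_fin mulr_ge0.
rewrite nnr_integralZl // nnr_integral_sum //; last 2 first.
- by move=> k; exact: measurable_funX.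
- by move=> k w _; exact: sqr_ge0.
apply: le_trans (lee_wpmul2l _ CN) _; first by rewrite lee_fin.
rewrite -EFinM lee_fin spectral_sumE mulrDr; apply: lerD.
  rewrite le_eqVlt; apply/orP; left; apply/eqP.
  rewrite /beta /stepsize -/(l ord0).
  set s := \sum_(k | _) _; have -> : ev lam 1 = l ord0 by [].
  by field; rewrite !gt_eqF.
rewrite -[leRHS]mulr1 expr2 invfM.
have : N%:R^-1 <= 1 / 2 :> R.
  by rewrite div1r lef_pV2 ?posrE // ler_nat.
have : 0 < N%:R^-1 :> R by rewrite invr_gt0.
by move=> h1 h2; have := ler_wpM2l (ltW h1) h2; lra.
Qed.

(* The factor reduces to its limit [1284] as soon as the main term of the bound
   dominates the remainder [1 / N]. *)
Definition inflation (R : realType) (N : nat) (bound : R) : R :=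
  1284 * Num.max 1 (N%:R^-1 / bound).

Lemma inflation_ge (R : realType) N (bound m : R) : 0 < bound -> m <= bound ->
  1280 * m + 4 / N%:R <= inflation N bound * bound.
Proof.
move=> b0 mb; rewrite /inflation -mulrA maxr_pMl ?(ltW b0) // mul1r divfK ?gt_eqF //.
have h1 : bound <= Num.max bound N%:R^-1 by rewrite le_max lexx.
have h2 : N%:R^-1 <= Num.max bound N%:R^-1 by rewrite le_max lexx orbT.
lra.
Qed.

Lemma inflation_const (R : realType) N (bound : R) : N%:R^-1 <= bound ->
  0 < bound -> inflation N bound = 1284.
Proof.
move=> Nb b0; rewrite /inflation max_l ?mulr1 //.
by rewrite ler_pdivrMr // mul1r.
Qed.

Definition bound1 (R : realType) (d N : nat) (lam : d.-tuple R) : R :=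
  ev lam 1 / gap lam * spectral_sum lam * (ln N%:R / N%:R).

Definition bound2 (R : realType) (d N : nat) (lam : d.-tuple R) : R :=
  ev lam 1 * ev lam 2 / gap lam ^+ 2 * ((d.-1)%:R * ln N%:R / N%:R).

Section bounds.
Context (R : realType) (d N : nat) (lam : d.-tuple R).
Hypothesis hlam : pca_spectrum lam.

Lemma ev1_gt0 : 0 < ev lam 1.
Proof. by have := gap_gt0 hlam; have := ev2_ge0 hlam; rewrite /gap; lra. Qed.

Lemma bound1_le_bound2 : (1 <= N)%N -> bound1 N lam <= bound2 N lam.
Proof.
move=> N1; have g0 := gap_gt0 hlam.
have -> : bound2 N lam = ev lam 1 / gap lam *
    ((d.-1)%:R * (ev lam 2 / gap lam)) * (ln N%:R / N%:R).
  by rewrite /bound2; field; rewrite gt_eqF ?ltr0n ?N1 ?gt_eqF.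
rewrite /bound1 ler_wpM2r //; first by rewrite divr_ge0 ?ler0n // ln_ge0 // ler1n.
rewrite ler_wpM2l ?spectral_sum_le //.
by rewrite divr_ge0 ?ltW // ev1_gt0.
Qed.

Lemma bound1_gt0 : 0 < ev lam 2 -> (1 < N)%N -> 0 < bound1 N lam.
Proof.
move=> l2 N1; have g0 := gap_gt0 hlam; have [d2 _ _ _] := hlam.
rewrite /bound1 mulr_gt0 //; last first.
  by rewrite divr_gt0 ?ln_gt0 ?ltr1n ?ltr0n // ltnW.
rewrite mulr_gt0 ?divr_gt0 ?ev1_gt0 //.
rewrite /spectral_sum big_ltn ?ltnS // ltr_wpDr ?divr_gt0 //.
rewrite big_nat; apply: sumr_ge0 => k /andP[k2 kd].
have /andP[h1 h2] : 0 <= ev lam k <= ev lam 2.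
  by apply: pca_spectrum_bounds => //; rewrite (ltnW k2) -ltnS.
by rewrite divr_ge0 //; move: g0; rewrite /gap; lra.
Qed.

Lemma inv_le_bound1 (c : R) : 0 < c -> 4 / c <= d%:R -> (1 < N)%N ->
  c <= d%:R^-1 * spectral_sum lam -> N%:R^-1 <= bound1 N lam.
Proof.
move=> c0 cd N1 hc; have g0 := gap_gt0 hlam; have l20 := ev2_ge0 hlam.
have N0 : 0 < N%:R :> R by rewrite ltr0n ltnW.
have L2 : 1 / 2 <= @ln R N%:R.
  have := @ln_ge_1BV R _ N0; have : N%:R^-1 <= 2^-1 :> R.
    by rewrite lef_pV2 ?posrE // ler_nat.
  lra.
have d0 : 0 < d%:R :> R by apply: lt_le_trans cd; rewrite divr_gt0.
have s4 : 4 <= spectral_sum lam.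
  move: hc; rewrite mulrC ler_pdivlMr // => hc; apply: le_trans hc.
  by rewrite mulrC -ler_pdivrMr.
have g1 : 1 <= ev lam 1 / gap lam.
  by rewrite ler_pdivlMr // mul1r /gap; lra.
rewrite /bound1 mulrA -[leLHS]mul1r ler_wpM2r ?invr_ge0 ?(ltW N0) //.
have : 1 * 4 <= ev lam 1 / gap lam * spectral_sum lam by apply: ler_pM; lra.
set p := _ * spectral_sum _ => p4.
have : 4 * (1 / 2) <= p * ln N%:R by apply: ler_pM; lra.
lra.
Qed.

Lemma inv_le_bound2 (c : R) : 0 < c -> 4 / c <= d%:R -> (1 < N)%N ->
  c <= ev lam 2 / ev lam 1 -> N%:R^-1 <= bound2 N lam.
Proof.
move=> c0 cd N1 hc; have g0 := gap_gt0 hlam; have l20 := ev2_ge0 hlam.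
have N0 : 0 < N%:R :> R by rewrite ltr0n ltnW.
have l10 := ev1_gt0; have [d2 _ _ _] := hlam.
have L2 : 1 / 2 <= @ln R N%:R.
  have := @ln_ge_1BV R _ N0; have : N%:R^-1 <= 2^-1 :> R.
    by rewrite lef_pV2 ?posrE // ler_nat.
  lra.
have g1 : gap lam <= ev lam 1 by rewrite /gap; lra.
have c1 : c <= ev lam 1 * ev lam 2 / gap lam ^+ 2.
  apply: le_trans hc _; rewrite ler_pdivlMr ?exprn_gt0 // mulrAC ler_pdivrMr //.
  rewrite mulrAC -expr2 mulrC ler_wpM2r //.
  by rewrite ler_pXn2r ?nnegrE ?(ltW g0) ?(ltW l10).
have d1 : d%:R / 2 <= (d.-1)%:R :> R.
  have -> : (d.-1)%:R = d%:R - 1 :> R.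
    by case: d d2 => // k _; rewrite /= -natr1 addrK.
  have : 2 <= d%:R :> R by rewrite ler_nat.
  lra.
have cd1 : 2 <= c * (d.-1)%:R.
  have h4 : 4 <= c * d%:R by rewrite mulrC -ler_pdivrMr.
  have := ler_wpM2l (ltW c0) d1; lra.
rewrite /bound2 !mulrA -[leLHS]mul1r ler_wpM2r ?invr_ge0 ?(ltW N0) //.
have h : c * (d.-1)%:R <= ev lam 1 * ev lam 2 / gap lam ^+ 2 * (d.-1)%:R.
  by rewrite ler_wpM2r ?ler0n.
have : 2 * (1 / 2) <= ev lam 1 * ev lam 2 / gap lam ^+ 2 * (d.-1)%:R * ln N%:R.
  by apply: ler_pM => //; lra.
lra.
Qed.

End bounds.

Theorem theorem3 (R : realType) :
  exists b3 C5 C6 : R,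
  [/\ 0 < b3, 0 < C5 & 0 < C6] /\
  (* arguments of the factors: d, N, delta, the eigenvalues, eps0 *)
  exists C1 C2 : forall d : nat, nat -> R -> d.-tuple R -> R -> R,
  [/\ (* the event and the two bounds *)
      forall (d : nat) (lam : d.-tuple R) (Sigma Sigma_half : 'M[R]_d)
        (ustar : 'cV[R]_d)
        (dZ : measure_display) (TZ : measurableType dZ)
        (PZ : probability TZ R) (Z : {RV PZ >-> 'cV[R]_d})
        (dX : measure_display) (T : measurableType dX)
        (P : probability T R) (X : nat -> {RV P >-> 'cV[R]_d})
        (u0 : {RV P >-> 'cV[R]_d})
        (eps0 : R) (N : nat) (delta : R),
      pca_spectrum lam ->
      psdmx Sigma -> has_spectrum Sigma lam ->
      psdmx Sigma_half -> Sigma_half *m Sigma_half = Sigma ->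
      enorm ustar = 1 -> Sigma *m ustar = ev lam 1 *: ustar ->
      standardized_subgaussian Z ->
      iid_copies Sigma_half Z X ->
      uniform_on_sphere (distribution P u0) ->
      independent_of_seq u0 X ->
      0 < eps0 < 8^-1 -> (1 <= N)%N -> 0 < delta ->
      0 < stepsize lam N ->
      condA b3 eps0 lam N delta -> condB C6 eps0 lam N delta ->
      let u (n : nat) (w : T) :=
        online_pca (stepsize lam N) (X ^~ w) (u0 w) n in
      exists A : set T,
      [/\ measurable A,
          ((1 - 2 * delta)%:E <= P A)%E,
          (* lambda_2 = 0 makes both bounds vanish, which no finite factor
             can compensate *)
          0 < ev lam 2 ->
          (\int[P]_(w in A) tan2_angle (u N w) ustar <=
           (C1 d N delta lam eps0 *
            (ev lam 1 / gap lam * spectral_sum lam * (ln N%:R / N%:R)))%:E)%E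
        & 0 < ev lam 2 ->
          (\int[P]_(w in A) tan2_angle (u N w) ustar <=
           (C2 d N delta lam eps0 *
            (ev lam 1 * ev lam 2 / gap lam ^+ 2 *
             ((d.-1)%:R * ln N%:R / N%:R)))%:E)%E],
      (* limit of the first factor *)
      forall eps0 c eta : R, 0 < eps0 < 8^-1 -> 0 < c -> 0 < eta ->
      exists M : nat, forall (d N : nat) (lam : d.-tuple R) (delta : R),
        (M <= d)%N -> (M <= N)%N -> pca_spectrum lam -> 0 < delta ->
        condA b3 eps0 lam N delta -> condB C6 eps0 lam N delta ->
        c <= d%:R^-1 * spectral_sum lam ->
        `|C1 d N delta lam eps0 - C5| < eta
    & (* limit of the second factor *)
      forall eps0 c eta : R, 0 < eps0 < 8^-1 -> 0 < c -> 0 < eta ->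
      exists M : nat, forall (d N : nat) (lam : d.-tuple R) (delta : R),
        (M <= d)%N -> (M <= N)%N -> pca_spectrum lam -> 0 < delta ->
        condA b3 eps0 lam N delta ->
        c <= ev lam 2 / ev lam 1 ->
        `|C2 d N delta lam eps0 - C5| < eta].
Proof.
exists (rate_constant R), 1284, 1; split.
  split; [by rewrite invr_gt0 mulr_gt0 ?ltr0n | by rewrite ltr0n | exact: ltr01].
exists (fun d N _ lam _ => inflation N (bound1 N lam)),
  (fun d N _ lam _ => inflation N (bound2 N lam)).
have threshold (c : R) : 0 < c -> exists M : nat, forall d N : nat,
    (M <= d)%N -> (M <= N)%N -> 4 / c <= d%:R /\ (1 < N)%N.
  move=> c0; exists (maxn 2 (Num.bound (4 / c))) => d N.
  rewrite !geq_max => /andP[_ Md] /andP[N2 _]; split=> //.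
  have /ltW h : 4 / c < (Num.bound (4 / c))%:R.
    by apply: archi_boundP; rewrite divr_ge0 // ltW.
  by apply: le_trans h _; rewrite ler_nat.
split.
- case=> [|n] lam Sigma Sigma_half ustar dZ TZ PZ Z dX T P X u0 eps0 N delta hlam.
    by case: hlam.
  move=> hS cS hM MM us Sus subgZ iidX unifU indepU heps N1 delta0 b0 hA hB u.
  have Ngt1 := N_gt1 b0.
  have small m : 0 <= m -> 0 < ev lam 2 -> bound1 N lam <= m ->
      (1280 * bound1 N lam + 4 / N%:R <= inflation N m * m) /\ 0 <= inflation N m * m.
    move=> m0 l2 bm; have b10 := bound1_gt0 hlam l2 Ngt1.
    have h := @inflation_ge R N m (bound1 N lam) (lt_le_trans b10 bm) bm.
    split; [exact: h | apply: le_trans h; apply: addr_ge0; last first].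
      by rewrite divr_ge0 ?ler0n.
    by apply: mulr_ge0; [exact: ler0n | exact: ltW].
  have b12 := bound1_le_bound2 hlam N1.
  have [d12|d12] := leP (1 / 2) delta.
    exists set0; split=> //.
    - by rewrite measure0 lee_fin; lra.
    - move=> l2; rewrite integral_set0 lee_fin.
      by have [] := small _ (ltW (bound1_gt0 hlam l2 Ngt1)) l2 (lexx _).
    - move=> l2; rewrite integral_set0 lee_fin.
      have b10 := bound1_gt0 hlam l2 Ngt1.
      by have [] := small _ (le_trans (ltW b10) b12) l2 b12.
  have hdelta : 0 < delta < 1 / 2 by rewrite delta0.
  have [A [mA PA IA]] := online_pca_tan2_bound hlam hS cS hM MM us Sus subgZ iidX
    unifU indepU heps hdelta b0 hA hB.
  exists A; split=> // l2; have b10 := bound1_gt0 hlam l2 Ngt1;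
    apply: le_trans IA _; rewrite lee_fin.
    by have [] := small _ (ltW b10) l2 (lexx _).
  by have [] := small _ (le_trans (ltW b10) b12) l2 b12.
- move=> eps0 c eta _ c0 eta0; have [M hM] := threshold c c0.
  exists M => d N lam delta Md MN hlam _ _ _ hc; have [cd N1] := hM d N Md MN.
  have h := inv_le_bound1 hlam c0 cd N1 hc.
  rewrite inflation_const ?subrr ?normr0 //.
  by apply: lt_le_trans h; rewrite invr_gt0 ltr0n ltnW.
- move=> eps0 c eta _ c0 eta0; have [M hM] := threshold c c0.
  exists M => d N lam delta Md MN hlam _ _ hc; have [cd N1] := hM d N Md MN.
  have h := inv_le_bound2 hlam c0 cd N1 hc.
  rewrite inflation_const ?subrr ?normr0 //.
  by apply: lt_le_trans h; rewrite invr_gt0 ltr0n ltnW.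
Qed.
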